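(* Consider the uncertain nonholonomic system $$\dot x_0=u_0,\quad \dot x_i=u_0x_{i+1}+\phi_i(t,u,x)\ (i=1,\dots,n-1),\quad \dot x_n=u+\phi_n(t,u,x),$$ with state $(x_0,x)\in\mathbf{R}\times\mathbf{R}^n$, $x=[x_1,\dots,x_n]^{\mathrm T}$, and controls $u_0,u\in\mathbf{R}$, where Assumption 1 holds. Let $T>0$, $\gamma_0=1/T$, $\beta=\frac{2n+\delta_c}{n}+2d\Lambda$, and apply the smooth time-varying state feedback $$u_0(t)=-\frac{3}{T-t}x_0(t)-\frac{\beta}{2}(T-t),\qquad u(t)=-\beta\, b^{\mathrm T}P(\gamma(t))L_n\!\left(\tfrac{1}{T-t}\right)x(t),\qquad \gamma(t)=\frac{T}{T-t}\gamma_0 .$$ Then there exist positive constants $\upsilon_1,\upsilon_{10},\upsilon_2,\upsilon_{20}$ (independent of the initial condition) such that, for any initial condition and all $t\in[0,T)$, the closed-loop solution satisfies $$|x_0(t)|\le (T-t)^2\Big(\frac{T-t}{T^3}|x_0(0)|+\frac{\beta t}{2T}\Big),$$ $$|u_0(t)|\le (T-t)\Big(3(T-t)\Big(\frac{|x_0(0)|}{T^3}+\frac{\beta}{2T}\Big)+\beta\Big),$$ $$\|x(t)\|\le \upsilon_1 (T-t)^{3/2}e^{\upsilon_{10}|x_0(0)|t}\|x(0)\|,\qquad \|u(t)\|\le \upsilon_2(T-t)^{1/2}e^{\upsilon_{20}|x_0(0)|t}\|x(0)\|.$$ In particular all states and controls converge to zero as $t\to T$.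
   Context: Assumption 1: the functions $\phi_i(t,u,x)$ are unknown continuous functions satisfying $|\phi_i(t,u,x)|\le c_{i1}|x_1|+\cdots+c_{ii}|x_i|$ with known constants $c_{ij}\ge 0$. $L_n(\gamma)=\mathrm{diag}\{\gamma^{n-1},\dots,\gamma,1\}$. $A\in\mathbf{R}^{n\times n}$ is the matrix with ones on the superdiagonal and zeros elsewhere, $b=[0,\dots,0,1]^{\mathrm T}\in\mathbf{R}^n$, $c=[1,0,\dots,0]\in\mathbf{R}^{1\times n}$. For $\gamma>0$, $P(\gamma)$ is the unique positive definite solution of $A^{\mathrm T}P+PA-Pbb^{\mathrm T}P=-\gamma P$; $P_n=P(1)$. $\Lambda=\lambda_{\max}(P_n)$. $E_n=\mathrm{diag}\{n-1,n-2,\dots,1,0\}$ and $\delta_c=n(1+\lambda_{\max}(E_n+P_nE_nP_n^{-1}))$. With $\gamma_0=1/T$, $g_{ij}=c_{ij}T^{i+1-j}$ ($j<i$), $g_{ii}=c_{ii}T+n-i$, and $d\ge0$ is defined by $d^2=\max_{j=1,\dots,n}\sum_{i=j}^n g_{ij}^2\, i\,\gamma_0^{-2(i-j)}$. *)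

(* Defs.v *)
From HB Require Import structures.
From mathcomp Require Import all_boot all_order all_algebra.
From mathcomp Require Import all_classical all_reals all_analysis.
Set Implicit Arguments. Unset Strict Implicit. Unset Printing Implicit Defensive.
Import Order.TTheory GRing.Theory Num.Theory.
Import numFieldNormedType.Exports.
Local Open Scope ring_scope.
Local Open Scope classical_set_scope.

(* All indices are 0-based: component i : 'I_n corresponds to x_(i+1). *)
Section Defs.
Variables (R : realType) (n : nat).

Definition Amat : 'M[R]_n := \matrix_(i, j) ((j : nat) == i.+1)%:R.
Definition bvec : 'cV[R]_n := \col_i ((i : nat) == n.-1)%:R.
Definition Lmat (g : R) : 'M[R]_n :=
  \matrix_(i, j) (((i == j)%:R) * g ^+ (n.-1 - i)).
Definition Emat : 'M[R]_n := \matrix_(i, j) ((i == j)%:R * (n.-1 - i)%:R).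

Definition posdef (M : 'M[R]_n) :=
  M^T = M /\ forall v : 'cV[R]_n, v != 0 -> 0 < (v^T *m M *m v) 0 0.

Definition riccati_sol (g : R) (M : 'M[R]_n) :=
  posdef M /\
  Amat^T *m M + M *m Amat - M *m bvec *m bvec^T *m M = - (g *: M).

(* P(g): the (unique) positive definite solution *)
Definition Pgam (g : R) : 'M[R]_n := xget 0 [set M | riccati_sol g M].

Definition lambda_max (M : 'M[R]_n) : R := sup [set l : R | root (char_poly M) l].

Definition Lambda : R := lambda_max (Pgam 1).

Definition delta_c : R :=
  n%:R * (1 + lambda_max (Emat + Pgam 1 *m Emat *m invmx (Pgam 1))).

(* g_ij (0-based), used for j <= i *)
Definition gcoef (c : 'I_n -> 'I_n -> R) (T : R) (i j : 'I_n) : R :=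
  if (j < i)%N then c i j * T ^+ (i.+1 - j) else c i i * T + (n - i.+1)%:R.

(* d >= 0 with d^2 = max_j sum_{i >= j} g_ij^2 (i+1) gamma0^(-2(i-j)), gamma0 = 1/T *)
Definition dconst (c : 'I_n -> 'I_n -> R) (T : R) : R :=
  Num.sqrt (\big[Num.max/0]_(j < n)
     \sum_(i < n | (j <= i)%N)
        (gcoef c T i j) ^+ 2 * (i.+1)%:R * ((1 / T)^-1) ^+ (2 * (i - j))).

Definition enorm (v : 'cV[R]_n) : R := Num.sqrt (\sum_i (v i 0) ^+ 2).

End Defs.

(* Main.v *)
Require Import Defs.
From HB Require Import structures.
From mathcomp Require Import all_boot all_order all_algebra.
From mathcomp Require Import all_classical all_reals all_analysis.
From mathcomp Require Import ring lra zify.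
Import Order.TTheory GRing.Theory Num.Theory.
Import numFieldNormedType.Exports.
Local Open Scope ring_scope.
Local Open Scope classical_set_scope.

(* With s = T - t and gamma = 1 / s, the x0-equation is solved explicitly and
   gives u0 = s (beta + w) with w = O(s). In the variables
   y = L(gamma) L(1 / s) x, i.e. y_i = s^(-2 (n - i)) x_i, the closed loop reads
     y' = gamma ((beta + w) A y - beta b b^T P y + E y + theta),
   where theta collects E y and the rescaled phi, and |theta| <= d |y|.
   For q = y^T P y with P = P_n, the Riccati equation turns the first two terms
   into -beta q at most, E contributes (delta_c / n - 1) q, and theta
   contributes 2 d Lambda q because P is similar to its inverse, so that its
   smallest eigenvalue is 1 / Lambda. Hence q' <= (-3 gamma + kappa) q with
   kappa affine in |x0(0)|, so q = O(s^3 e^(kappa t)), which yields the rates. *)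

(** * Quadratic forms and generalized Rayleigh quotients *)

(** [Pgam] is defined by choice and [lambda_max] by a supremum of roots, so both must be pinned down
    before any estimate. For [Pgam] a solution is exhibited: the Riccati equation is linear in
    [P^-1], at [g = 1] it is solved by signed binomial coefficients, and general [g] follows by
    conjugation with [L(g)]. The factorization [P = F^T F] with [F F = 1] yields both the
    definiteness of [P] and its similarity to [P^-1]. The bounds by [lambda_max] use no
    diagonalization, only Rayleigh quotients and Cauchy-Schwarz.

    The constant [beta = 2 + delta_c / n + 2 d Lambda] is a budget: after paying for [E] and [theta]
    it leaves exactly the rate -3. As the feedback carries a factor [1 / s], a rate beyond 2 is
    needed for [u] to vanish. The value [x0(0)] enters the decay only through [w], hence only
    through the exponential. *)

Definition bform {R : realType} {n : nat} (M : 'M[R]_n) (u v : 'cV[R]_n) : R :=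
  (u^T *m M *m v) 0 0.

Lemma bformDl {R : realType} {n : nat} (M : 'M[R]_n) u1 u2 v :
  bform M (u1 + u2) v = bform M u1 v + bform M u2 v.
Proof. by rewrite /bform linearD /= !mulmxDl mxE. Qed.

Lemma bformDr {R : realType} {n : nat} (M : 'M[R]_n) u v1 v2 :
  bform M u (v1 + v2) = bform M u v1 + bform M u v2.
Proof. by rewrite /bform mulmxDr mxE. Qed.

Lemma bformZl {R : realType} {n : nat} (M : 'M[R]_n) a u v :
  bform M (a *: u) v = a * bform M u v.
Proof. by rewrite /bform linearZ /= -!scalemxAl mxE. Qed.

Lemma bformZr {R : realType} {n : nat} (M : 'M[R]_n) a u v :
  bform M u (a *: v) = a * bform M u v.
Proof. by rewrite /bform -scalemxAr mxE. Qed.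

Lemma bformD {R : realType} {n : nat} (M N : 'M[R]_n) u v :
  bform (M + N) u v = bform M u v + bform N u v.
Proof. by rewrite /bform mulmxDr mulmxDl mxE. Qed.

Lemma bformN {R : realType} {n : nat} (M : 'M[R]_n) u v :
  bform (- M) u v = - bform M u v.
Proof. by rewrite /bform mulmxN mulNmx mxE. Qed.

Lemma bformZ {R : realType} {n : nat} a (M : 'M[R]_n) u v :
  bform (a *: M) u v = a * bform M u v.
Proof. by rewrite /bform -scalemxAr -scalemxAl mxE. Qed.

Lemma bform_trmx {R : realType} {n : nat} (M : 'M[R]_n) u v :
  bform M^T u v = bform M v u.
Proof.
rewrite /bform; transitivity ((u^T *m M^T *m v)^T 0 0); first by rewrite [RHS]mxE.
by rewrite !trmx_mul !trmxK mulmxA.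
Qed.

Lemma bform_mulr {R : realType} {n : nat} (M N : 'M[R]_n) u v :
  bform (M *m N) u v = bform M u (N *m v).
Proof. by rewrite /bform !mulmxA. Qed.

Lemma bform1 {R : realType} {n : nat} (v : 'cV[R]_n) :
  bform 1%:M v v = \sum_i v i 0 ^+ 2.
Proof.
by rewrite /bform mulmx1 mxE; apply: eq_bigr => i _; rewrite mxE expr2.
Qed.

Lemma bform_sum {R : realType} {n : nat} (M : 'M[R]_n) u v :
  bform M u v = \sum_i \sum_j M i j * (u i 0 * v j 0).
Proof.
rewrite /bform mxE exchange_big; apply: eq_bigr => j _ /=.
rewrite mxE mulr_suml; apply: eq_bigr => i _; rewrite mxE; ring.
Qed.

Lemma bform_delta {R : realType} {n : nat} (M : 'M[R]_n) (i : 'I_n) v :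
  bform M (delta_mx i 0) v = (M *m v) i 0.
Proof. by rewrite /bform trmx_delta -mulmxA -rowE mxE. Qed.

Lemma sqr_le_sumsq {R : realType} {n : nat} (v : 'cV[R]_n) i :
  v i 0 ^+ 2 <= \sum_i v i 0 ^+ 2.
Proof.
by rewrite (bigD1 i) //= lerDl sumr_ge0 // => j _; rewrite sqr_ge0.
Qed.

(** Only semidefiniteness is assumed, since the inequality also serves to prove definiteness of a
    form. The discriminant argument therefore has a degenerate case. *)
Lemma cauchy_schwarz {R : realType} {n : nat} (M : 'M[R]_n) u v :
  M^T = M -> (forall w, 0 <= bform M w w) ->
  bform M u v ^+ 2 <= bform M u u * bform M v v.
Proof.
move=> Msym Mpsd.
have vu : bform M v u = bform M u v by rewrite -bform_trmx Msym.
have H t : 0 <= bform M u u + 2 * t * bform M u v + t ^+ 2 * bform M v v.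
  have := Mpsd (u + t *: v).
  rewrite bformDl !bformDr !bformZl !bformZr vu => h.
  by apply: le_trans h _; rewrite le_eqVlt; apply/orP; left; apply/eqP; ring.
have [v0|v0] := eqVneq (bform M v v) 0.
  rewrite v0 mulr0; suff -> : bform M u v = 0 by rewrite expr0n.
  apply/eqP/negPn/negP => uv0.
  (* Without its quadratic term the polynomial is affine in [t]; this [t] gives it the value -1. *)
  have := H (- (bform M u u + 1) / (2 * bform M u v)).
  rewrite v0 mulr0 addr0.
  have -> : 2 * (- (bform M u u + 1) / (2 * bform M u v)) * bform M u v
            = - (bform M u u + 1) by field.
  by rewrite opprD addrA subrr add0r oppr_ge0 ler10.
have vp : 0 < bform M v v by rewrite lt_neqAle eq_sym v0 Mpsd.
have := H (- bform M u v / bform M v v).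
have -> : bform M u u + 2 * (- bform M u v / bform M v v) * bform M u v
   + (- bform M u v / bform M v v) ^+ 2 * bform M v v
   = bform M u u - bform M u v ^+ 2 / bform M v v by field.
by rewrite subr_ge0 ler_pdivrMr.
Qed.

Lemma posdef_psd {R : realType} {n : nat} (M : 'M[R]_n) v :
  posdef M -> 0 <= bform M v v.
Proof.
move=> [_ Mpos]; have [->|/Mpos/ltW//] := eqVneq v 0.
by rewrite /bform mulmx0 mxE.
Qed.

Lemma singular_mulmx {R : realType} {n : nat} (M : 'M[R]_n) :
  (M \notin unitmx) <-> exists2 v : 'cV[R]_n, v != 0 & M *m v = 0.
Proof.
rewrite -unitmx_tr unitmxE unitfE negbK; split.
  move=> /det0P[v v0 vM]; exists v^T; first by rewrite trmx_eq0.
  by apply: trmx_inj; rewrite trmx_mul trmxK vM trmx0.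
move=> [v v0 vM]; apply/det0P; exists v^T; first by rewrite trmx_eq0.
by rewrite -trmx_mul vM trmx0.
Qed.

Lemma posdef_unitmx {R : realType} {n : nat} (M : 'M[R]_n) :
  posdef M -> M \in unitmx.
Proof.
move=> [_ Mpos]; apply/negPn/negP => /singular_mulmx[v /Mpos + Mv].
by rewrite -mulmxA Mv mulmx0 mxE ltxx.
Qed.

(** By Cauchy-Schwarz a null vector of a semidefinite form is orthogonal to every basis vector,
    hence lies in the kernel of [M]. *)
Lemma psd_unitmx_posdef {R : realType} {n : nat} (M : 'M[R]_n) :
  M^T = M -> (forall w, 0 <= bform M w w) -> M \in unitmx -> posdef M.
Proof.
move=> Msym Mpsd Mu; split => // v v0.
rewrite lt_neqAle Mpsd andbT eq_sym; apply/negP => /eqP vMv.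
have Mv : M *m v = 0.
  apply/matrixP => i j; rewrite ord1 -bform_delta [RHS]mxE; apply/eqP.
  rewrite -sqrf_eq0 eq_le sqr_ge0 andbT.
  by apply: le_trans (cauchy_schwarz M _ _ Msym Mpsd) _; rewrite /bform vMv mulr0.
by have := mulKmx Mu v; rewrite Mv mulmx0 => /esym/eqP; rewrite (negPf v0).
Qed.

(** With [e_i = M^-1 delta_i] one has [v_i = e_i^T M v], and Cauchy-Schwarz for [M] bounds its
    square. The constant is explicit, with no compactness argument; the summand 1 keeps it positive
    even for [n = 0]. *)
Lemma posdef_coercive {R : realType} {n : nat} (M : 'M[R]_n) :
  posdef M -> exists2 C : R, 0 < C &
    forall v : 'cV[R]_n, \sum_i v i 0 ^+ 2 <= C * bform M v v.
Proof.
move=> Mpd; have Mu := posdef_unitmx _ Mpd; case: (Mpd) => Msym Mpos.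
pose e i : 'cV[R]_n := invmx M *m delta_mx i 0.
exists (1 + \sum_i bform M (e i) (e i)).
  by rewrite ltr_pwDl // sumr_ge0 // => i _; apply: posdef_psd.
move=> v; rewrite mulrDl mul1r ler_wpDl ?posdef_psd // mulr_suml.
apply: ler_sum => i _.
suff -> : v i 0 = bform M (e i) v.
  by apply: cauchy_schwarz => // w; apply: posdef_psd.
by rewrite /bform /e trmx_mul trmx_inv Msym mulmxKV // trmx_delta -rowE mxE.
Qed.

Lemma bform_bounded {R : realType} {n : nat} (N : 'M[R]_n) :
  exists2 C : R, 0 < C & forall v : 'cV[R]_n, `|bform N v v| <= C * \sum_i v i 0 ^+ 2.
Proof.
exists (1 + \sum_i \sum_j `|N i j|).
  by rewrite ltr_pwDl // sumr_ge0 // => i _; rewrite sumr_ge0.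
move=> v; set S := \sum_i _ ^+ 2.
have S0 : 0 <= S by rewrite sumr_ge0 // => i _; rewrite sqr_ge0.
rewrite mulrDl mul1r ler_wpDl // bform_sum mulr_suml.
apply: le_trans (ler_norm_sum _ _ _) _; apply: ler_sum => i _.
rewrite mulr_suml; apply: le_trans (ler_norm_sum _ _ _) _.
apply: ler_sum => j _; rewrite normrM ler_wpM2l //.
have := sqr_le_sumsq v i; have := sqr_le_sumsq v j; rewrite -/S => hi hj.
have := sqr_ge0 (v i 0 - v j 0); have := sqr_ge0 (v i 0 + v j 0).
by rewrite ler_norml => h1 h2; apply/andP; split; nra.
Qed.

Lemma bform_bounded_posdef {R : realType} {n : nat} (N P : 'M[R]_n) :
  posdef P -> exists2 C : R, 0 < C & forall v : 'cV[R]_n, `|bform N v v| <= C * bform P v v.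
Proof.
move=> /posdef_coercive[C C0 hC]; have [D D0 hD] := bform_bounded N.
exists (D * C); first exact: mulr_gt0.
by move=> v; apply: le_trans (hD v) _; rewrite -mulrA ler_wpM2l // ltW.
Qed.

Lemma det_char_poly {R : realType} {n : nat} (M : 'M[R]_n) a :
  (char_poly M).[a] = \det (a%:M - M).
Proof.
rewrite /char_poly -horner_evalE -det_map_mx; congr determinant.
apply/matrixP => i j; rewrite !mxE /= horner_evalE hornerD hornerN hornerC.
by rewrite hornerMn hornerX.
Qed.

(* [lambda_max (N P^-1)] is the largest generalized Rayleigh quotient
   [v^T N v / v^T P v]: if [nu] denotes the supremum of these quotients, then
   [nu P - N] is semidefinite but not definite, hence singular. *)
Lemma le_lambda_max {R : realType} {n : nat} (N P : 'M[R]_n) v :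
  N^T = N -> posdef P ->
  bform N v v <= lambda_max (N *m invmx P) * bform P v v.
Proof.
move=> Nsym Ppd; have Pu := posdef_unitmx _ Ppd; case: (Ppd) => Psym Ppos.
have [->|v0] := eqVneq v 0; first by rewrite /bform !mulmx0 !mxE mulr0.
pose S := [set r : R | exists2 w : 'cV[R]_n,
  w != 0 & r = bform N w w / bform P w w].
have [C C0 hC] := bform_bounded_posdef N P Ppd.
have Sbnd : has_ubound S.
  exists C => r [w w0 ->]; rewrite ler_pdivrMr; last exact: Ppos.
  by apply: le_trans (hC w); rewrite ler_norm.
have Sne : S !=set0 by exists (bform N v v / bform P v v); exists v.
pose nu := sup S.
have nuP w : bform N w w <= nu * bform P w w.
  have [->|w0] := eqVneq w 0; first by rewrite /bform !mulmx0 !mxE mulr0.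
  rewrite -ler_pdivrMr; last exact: Ppos.
  by apply: ub_le_sup => //; exists w.
pose M := nu *: P - N.
have ME w : bform M w w = nu * bform P w w - bform N w w.
  by rewrite bformD bformN bformZ.
have Msym : M^T = M by rewrite /M linearB /= linearZ /= Psym Nsym.
have Mpsd w : 0 <= bform M w w by rewrite ME subr_ge0.
have root_sing a : root (char_poly (N *m invmx P)) a =
    (a *: P - N \notin unitmx).
  rewrite rootE det_char_poly unitmxE unitfE negbK.
  rewrite -[a *: P - N](mulmxKV Pu) det_mulmx mulf_eq0.
  have /negPf -> : \det P != 0 by rewrite -unitfE -unitmxE.
  by rewrite orbF mulmxBl -scalemxAl mulmxV // scalemx1.
have Msing : M \notin unitmx.
  apply/negP => Mu.
  (* If [M] were definite, then [P <= D M], and [nu - 1 / D] would still bound every quotient,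
     against the choice of [nu]. *)
  have Mpd : posdef M by apply: psd_unitmx_posdef.
  have [D D0 hD] := bform_bounded_posdef P M Mpd.
  suff : nu <= nu - D^-1 by rewrite leNgt ltrBlDr ltrDl invr_gt0 D0.
  apply: ge_sup => // r [w w0 ->]; rewrite ler_pdivrMr; last exact: Ppos.
  rewrite mulrBl lerBrDr addrC -lerBrDr -ME.
  rewrite mulrC ler_pdivrMr // mulrC; apply: le_trans (hD w).
  exact: ler_norm.
apply: le_trans (nuP v) _; rewrite ler_wpM2r ?posdef_psd //.
apply: ub_le_sup; last by rewrite /= root_sing.
(* Comparing [nu] with the supremum of the roots requires these to be bounded above: each root is
   itself a quotient, taken at a kernel vector. *)
exists nu => r /=; rewrite root_sing => /singular_mulmx[w w0 rw].
apply: ub_le_sup => //; exists w => //.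
apply/eqP; rewrite eq_sym -subr_eq0; apply/eqP.
have : bform (r *: P - N) w w = 0.
  by rewrite /bform -mulmxA rw mulmx0 mxE.
rewrite bformD bformN bformZ => /eqP; rewrite subr_eq0 => /eqP <-.
by rewrite mulfK ?subrr // gt_eqF //; apply: Ppos.
Qed.

(** * The parametric Riccati equation *)

(** Pascal's rule on [C(i+1, k)] and a shift of [k] reduce [i + 1] to [i]. The range [N] is
    decoupled from [i] because the shift shortens it by one. *)
Lemma binomial_inversion {R : realType} (N i j : nat) : (i < N)%N ->
  \sum_(k < N) (-1) ^+ k * 'C(i, k)%:R * 'C(k, j)%:R
  = (-1) ^+ i * (i == j)%:R :> R.
Proof.
elim: i j N => [|i IHi] j [//|N] iN.
  rewrite big_ord_recl big1 => [|k _]; last by rewrite lift0 bin0n mulr0 mul0r.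
  by rewrite addr0 !expr0 !mul1r bin0n eq_sym.
have iN1 : (i < N.+1)%N by lia.
have -> : \sum_(k < N.+1) (-1) ^+ k * 'C(i.+1, k)%:R * 'C(k, j)%:R
  = \sum_(k < N.+1) (-1) ^+ k * 'C(i, k)%:R * 'C(k, j)%:R
    - \sum_(k < N) (-1) ^+ k * 'C(i, k)%:R * 'C(k.+1, j)%:R :> R.
  rewrite !big_ord_recl !bin0 -addrA; congr (_ + _).
  rewrite -sumrB; apply: eq_bigr => k _; rewrite /= /bump /= !add1n binS natrD.
  by rewrite exprS; ring.
rewrite IHi //; case: j => [|j].
  under [X in _ - X]eq_bigr => k _ do rewrite bin0 -(bin0 k).
  by rewrite IHi // subrr mulr0.
under [X in _ - X]eq_bigr => k _ do rewrite binS natrD mulrDr.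
by rewrite big_split /= !IHi // eqSS exprS; ring.
Qed.

Lemma binomial_sum {R : realType} (N p q : nat) : (p < N)%N ->
  \sum_(k < N) 'C(p, k)%:R * 'C(q, k)%:R = 'C(p + q, p)%:R :> R.
Proof.
move=> pN; rewrite addnC -(binomial.Vandermonde q p p) natr_sum.
rewrite (big_ord_widen N (fun k => ('C(q, k) * 'C(p, p - k))%:R)) //.
rewrite [RHS]big_mkcond; apply: eq_bigr => k _; rewrite ltnS.
case: leqP => kp; first by rewrite bin_sub // natrM mulrC.
by rewrite bin_small // mul0r.
Qed.

(* An involution [F] with [F F^T] equal to the controllability Gramian of
   [(A, b)]; then [F^T F] is the inverse of that Gramian. *)
Definition Fmat (R : realType) (n : nat) : 'M[R]_n :=
  \matrix_(i, j) ((-1) ^+ (n.-1 - i) * 'C(n.-1 - i, n.-1 - j)%:R).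

Lemma rev_ordE (n : nat) (i : 'I_n) : (n.-1 - rev_ord i = i)%N.
Proof. by rewrite /=; have := ltn_ord i; lia. Qed.

(** Up to the index reversal [i -> n - 1 - i], [F] is the signed Pascal matrix, which is its own
    inverse by binomial inversion. *)
Lemma Fmat_invol {R : realType} {n : nat} : Fmat R n *m Fmat R n = 1%:M.
Proof.
apply/matrixP => i j; rewrite !mxE (reindex_inj rev_ord_inj) /=.
have lti := ltn_ord i; have ltj := ltn_ord j.
under eq_bigr => k _ do rewrite !mxE (rev_ordE _ k).
have -> : \sum_(k < n) (-1) ^+ (n.-1 - i) * 'C(n.-1 - i, k)%:R
    * ((-1) ^+ k * 'C(k, n.-1 - j)%:R)
   = (-1) ^+ (n.-1 - i) * \sum_(k < n) (-1) ^+ k * 'C(n.-1 - i, k)%:R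
    * 'C(k, n.-1 - j)%:R :> R.
  by rewrite mulr_sumr; apply: eq_bigr => k _; ring.
rewrite binomial_inversion; last by lia.
rewrite mulrA -expr2 sqrr_sign mul1r.
by congr (_%:R); rewrite -val_eqE /=; lia.
Qed.

Definition Wmat (R : realType) (n : nat) : 'M[R]_n := Fmat R n *m (Fmat R n)^T.
Definition Pmat (R : realType) (n : nat) : 'M[R]_n := (Fmat R n)^T *m Fmat R n.

Lemma Wmat_mulP {R : realType} {n : nat} : Wmat R n *m Pmat R n = 1%:M.
Proof.
rewrite /Wmat /Pmat -mulmxA (mulmxA _^T _^T) -trmx_mul Fmat_invol trmx1.
by rewrite mul1mx Fmat_invol.
Qed.

Lemma Pmat_unit {R : realType} {n : nat} : Pmat R n \in unitmx.
Proof. by case: (mulmx1_unit (@Wmat_mulP R n)). Qed.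

Lemma invmx_Pmat {R : realType} {n : nat} : invmx (Pmat R n) = Wmat R n.
Proof.
by rewrite -[LHS]mul1mx -(@Wmat_mulP R n) mulmxK // Pmat_unit.
Qed.

(** These are the entries of the Gramian, the integral of [e^(-t) e^(-A t) b b^T e^(-A^T t)] over
    [t >= 0]: with [k = n-1-i] and [l = n-1-j] it integrates [(-t)^(k+l) / (k! l!)] against
    [e^(-t)]. Here they follow from Vandermonde's identity instead. *)
Lemma WmatE {R : realType} {n : nat} (i j : 'I_n) :
  Wmat R n i j = (-1) ^+ ((n.-1 - i) + (n.-1 - j))
    * 'C((n.-1 - i) + (n.-1 - j), n.-1 - i)%:R.
Proof.
have lti := ltn_ord i.
rewrite mxE (reindex_inj rev_ord_inj) /=.
rewrite -(@binomial_sum _ n); last by lia.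
rewrite mulr_sumr; apply: eq_bigr => k _; rewrite !mxE (rev_ordE _ k) exprD.
ring.
Qed.

Lemma sum_shift {R : realType} {n : nat} (i : nat) (f : nat -> R) :
  \sum_(k < n) ((k : nat) == i.+1)%:R * f k = (i.+1 < n)%:R * f i.+1.
Proof.
case: ltnP => [lin|nli].
  rewrite (bigD1 (Ordinal lin)) //= eqxx big1 ?addr0 // => k.
  by rewrite -val_eqE /= => /negPf ->; rewrite mul0r.
rewrite mul0r big1 // => k _; have := ltn_ord k.
by case: eqP => [|_]; [lia|rewrite mul0r].
Qed.

(** Extending the column to a function [f] on the naturals lets row [i + 1] be named even at the
    last index, where the indicator removes it. *)
Lemma Amat_mul {R : realType} {n m : nat} (M : 'M[R]_(n, m)) (f : nat -> R) i j :
  (forall k, M k j = f k) -> (@Amat R n *m M) i j = (i.+1 < n)%:R * f i.+1.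
Proof.
by move=> Mf; rewrite mxE -sum_shift; apply: eq_bigr => k _; rewrite mxE Mf.
Qed.

Lemma mul_Amat_tr {R : realType} {n m : nat} (M : 'M[R]_(m, n)) (f : nat -> R) i j :
  (forall k, M i k = f k) -> (M *m (@Amat R n)^T) i j = (j.+1 < n)%:R * f j.+1.
Proof.
move=> Mf; rewrite mxE -sum_shift; apply: eq_bigr => k _.
by rewrite !mxE Mf mulrC.
Qed.

(** Counting indices from the end, each entry is Pascal's rule with alternating signs. On the border
    one shifted term drops out, and in the corner only the entry 1 of [b b^T] remains. *)
Lemma Wmat_lyapunov {R : realType} {n : nat} :
  @Amat R n *m Wmat R n + Wmat R n *m (@Amat R n)^T + Wmat R n
  = @bvec R n *m (@bvec R n)^T.
Proof.
apply/matrixP => i j.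
have lti := ltn_ord i; have ltj := ltn_ord j.
pose w (k l : nat) : R := (-1) ^+ ((n.-1 - k) + (n.-1 - l))
    * 'C((n.-1 - k) + (n.-1 - l), n.-1 - k)%:R.
rewrite mxE [X in X + _]mxE (Amat_mul _ (w^~ j)) => [|k]; last exact: WmatE.
rewrite (mul_Amat_tr _ (w i)) => [|k]; last exact: WmatE.
rewrite WmatE mxE big_ord1 !mxE /w.
have [a ea] : {a | (n.-1 - i = a)%N} by exists (n.-1 - i)%N.
have [b eb] : {b | (n.-1 - j = b)%N} by exists (n.-1 - j)%N.
have -> : ((i : nat) == n.-1) = (a == 0%N) by lia.
have -> : ((j : nat) == n.-1) = (b == 0%N) by lia.
have -> : (i.+1 < n)%N = (0 < a)%N by lia.
have -> : (j.+1 < n)%N = (0 < b)%N by lia.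
have -> : (n.-1 - i.+1 = a.-1)%N by lia.
have -> : (n.-1 - j.+1 = b.-1)%N by lia.
rewrite ea eb; case: a {ea} => [|a]; case: b {eb} => [|b] /=.
- by rewrite bin0 expr0; ring.
- by rewrite !add0n !bin0 exprS; ring.
- by rewrite !addn0 !binn exprS; ring.
rewrite !addSn !addnS (binS (a + b).+1) natrD !exprS; ring.
Qed.

(** Multiplying the Lyapunov residual by [P] on both sides gives the Riccati residual. Existence and
    uniqueness thus become linear questions about the inverse. *)
Lemma riccati_lyapunov {R : realType} {n : nat} (g : R) (P : 'M[R]_n) :
  P \in unitmx ->
  (@Amat R n)^T *m P + P *m @Amat R n
    - P *m @bvec R n *m (@bvec R n)^T *m P = - (g *: P) <->
  @Amat R n *m invmx P + invmx P *m (@Amat R n)^T + g *: invmx P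
    = @bvec R n *m (@bvec R n)^T.
Proof.
move=> Pu; set A := Amat _ _; set b := bvec _ _.
have E : P *m (A *m invmx P + invmx P *m A^T + g *: invmx P - b *m b^T) *m P
   = A^T *m P + P *m A - P *m b *m b^T *m P + g *: P.
  rewrite mulmxDr mulmxN !mulmxDr -scalemxAr mulmxV //.
  rewrite mulmxDl mulNmx !mulmxDl -scalemxAl mul1mx !mulmxA mulmxV // mul1mx.
  rewrite mulmxKV // [P *m A + _]addrC -!addrA; congr (_ + (_ + _)).
  by rewrite addrC.
split=> /eqP; rewrite -subr_eq0.
  rewrite opprK -E => /eqP /(congr1 (fun M => invmx P *m M *m invmx P)).
  rewrite !mulmxA mulmx0 mul0mx mulVmx // mul1mx mulmxK //.
  by move/eqP; rewrite subr_eq0 => /eqP.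
move=> /eqP H; apply/eqP; rewrite -subr_eq0 opprK -E H.
by rewrite mulmx0 mul0mx.
Qed.

(** Entrywise the equation reads [D_(i+1,j) + D_(i,j+1) + g D_(i,j) = 0], with absent terms past the
    border, so [D] vanishes by induction on the distance to the last corner. *)
Lemma lyapunov_uniq {R : realType} {n : nat} (g : R) (D : 'M[R]_n) : g != 0 ->
  @Amat R n *m D + D *m (@Amat R n)^T + g *: D = 0 -> D = 0.
Proof.
move=> g0 HD.
suff H m (i j : 'I_n) : ((n - i) + (n - j) < m)%N -> D i j = 0.
  by apply/matrixP => i j; rewrite (H (n - i + (n - j)).+1) // mxE.
elim: m i j => // m IHm i j ltm.
have lti := ltn_ord i; have ltj := ltn_ord j.
move/matrixP: HD => /(_ i j).
rewrite [LHS]mxE [(_ *m _ + _ *m _) i j]mxE [(g *: D) i j]mxE.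
rewrite [(_ *m D) i j]mxE [(D *m _) i j]mxE.
rewrite big1 => [|k _]; last first.
  rewrite !mxE; case: eqP => [ki|_]; last by rewrite mul0r.
  by rewrite IHm ?mulr0 //; lia.
rewrite big1 => [|k _]; last first.
  rewrite !mxE; case: eqP => [ki|_]; last by rewrite mulr0.
  by rewrite IHm ?mul0r //; lia.
by rewrite !add0r mxE => /eqP; rewrite mulf_eq0 (negPf g0) => /eqP.
Qed.

Lemma riccati_uniq {R : realType} {n : nat} (g : R) (P Q : 'M[R]_n) : g != 0 ->
  riccati_sol g P -> riccati_sol g Q -> P = Q.
Proof.
move=> g0 [Ppd PR] [Qpd QR].
have Pu := posdef_unitmx _ Ppd; have Qu := posdef_unitmx _ Qpd.
move/(riccati_lyapunov _ _ Pu) in PR; move/(riccati_lyapunov _ _ Qu) in QR.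
apply: (can_inj (@invmxK R n)); apply/eqP; rewrite -subr_eq0; apply/eqP.
apply: (lyapunov_uniq g) => //.
rewrite mulmxBr mulmxBl scalerBr.
rewrite [X in X + _]addrACA -opprD addrACA -opprD PR QR subrr //.
Qed.

Lemma Pmat_posdef {R : realType} {n : nat} : posdef (Pmat R n).
Proof.
apply: psd_unitmx_posdef Pmat_unit; first by rewrite trmx_mul trmxK.
move=> w; suff -> : bform (Pmat R n) w w = bform 1%:M (Fmat R n *m w) (Fmat R n *m w).
  by rewrite bform1 sumr_ge0 // => i _; rewrite sqr_ge0.
by rewrite /bform mulmx1 trmx_mul !mulmxA.
Qed.

Lemma Pmat_riccati {R : realType} {n : nat} : riccati_sol 1 (Pmat R n).
Proof.
split; first exact: Pmat_posdef.
apply/riccati_lyapunov; first exact: Pmat_unit.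
by rewrite invmx_Pmat scale1r Wmat_lyapunov.
Qed.

(** * The scaling [L(g)] and the Riccati solution for general [g] *)

Lemma Lmat_diag {R : realType} {n : nat} (g : R) :
  @Lmat R n g = diag_mx (\row_i g ^+ (n.-1 - i)).
Proof.
by apply/matrixP => i j; rewrite !mxE; case: eqP => _; rewrite ?mul1r ?mul0r.
Qed.

Lemma Emat_diag {R : realType} {n : nat} :
  @Emat R n = diag_mx (\row_i (n.-1 - i)%:R).
Proof.
by apply/matrixP => i j; rewrite !mxE; case: eqP => _; rewrite ?mul1r ?mul0r.
Qed.

Lemma Lmat_Amat {R : realType} {n : nat} (g : R) :
  @Lmat R n g *m @Amat R n = g *: (@Amat R n *m @Lmat R n g).
Proof.
rewrite Lmat_diag; apply/matrixP => i j.
rewrite mul_diag_mx [RHS]mxE mul_mx_diag !mxE.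
have ltj := ltn_ord j.
case: eqP => [ji|_]; last by rewrite mul0r !mulr0.
by rewrite mulr1 mul1r -exprS; congr (_ ^+ _); lia.
Qed.

Lemma Lmat_bvec {R : realType} {n : nat} (g : R) :
  @Lmat R n g *m @bvec R n = @bvec R n.
Proof.
rewrite Lmat_diag; apply/matrixP => i j; rewrite mul_diag_mx !mxE.
by case: eqP => [->|_]; rewrite ?subnn ?expr0 ?mulr1 ?mulr0.
Qed.

Lemma Lmat_sym {R : realType} {n : nat} (g : R) : (@Lmat R n g)^T = @Lmat R n g.
Proof. by rewrite Lmat_diag tr_diag_mx. Qed.

Lemma Lmat_mul {R : realType} {n : nat} (g h : R) :
  @Lmat R n g *m @Lmat R n h = @Lmat R n (g * h).
Proof.
rewrite !Lmat_diag mulmx_diag; congr diag_mx; apply/rowP => i.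
by rewrite !mxE exprMn.
Qed.

Lemma Lmat1 {R : realType} {n : nat} : @Lmat R n 1 = 1%:M.
Proof. by apply/matrixP => i j; rewrite !mxE expr1n mulr1. Qed.

Lemma Lmat_posdef {R : realType} {n : nat} (g : R) (P : 'M[R]_n) : 0 < g ->
  posdef P -> posdef (g *: (@Lmat R n g *m P *m @Lmat R n g)).
Proof.
move=> g0 [Psym Ppos]; split.
  by rewrite linearZ /= !trmx_mul Lmat_sym Psym mulmxA.
move=> v v0; rewrite -scalemxAr -scalemxAl mxE mulr_gt0 //.
have := Ppos (@Lmat R n g *m v); rewrite trmx_mul Lmat_sym !mulmxA; apply.
apply: contraNN v0 => /eqP Lv; rewrite -[v]mul1mx -Lmat1 -(mulVf (lt0r_neq0 g0)).
by rewrite -Lmat_mul -mulmxA Lv mulmx0.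
Qed.

(** Since [L A = g A L] and [L b = b], every term of the equation for [g L P L] is [g^2 L M L], with
    [M] the matching term for [P]. *)
Lemma Lmat_riccati {R : realType} {n : nat} (g : R) (P : 'M[R]_n) : 0 < g ->
  riccati_sol 1 P -> riccati_sol g (g *: (@Lmat R n g *m P *m @Lmat R n g)).
Proof.
move=> g0 [Ppd PR]; split; first exact: Lmat_posdef.
move: PR; set A := Amat _ _; set b := bvec _ _; set L := Lmat _ g => PR.
have LA : L *m A = g *: (A *m L) by exact: Lmat_Amat.
have AL : A^T *m L = g *: (L *m A^T).
  by rewrite -[L in LHS]Lmat_sym -trmx_mul LA linearZ /= trmx_mul Lmat_sym.
have Lb : L *m b = b by exact: Lmat_bvec.
have bL : b^T *m L = b^T by rewrite -[L in LHS]Lmat_sym -trmx_mul Lb.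
have -> : A^T *m (g *: (L *m P *m L)) = (g ^+ 2) *: (L *m (A^T *m P) *m L).
  by rewrite -scalemxAr !mulmxA AL -!scalemxAl scalerA.
have -> : g *: (L *m P *m L) *m A = (g ^+ 2) *: (L *m (P *m A) *m L).
  by rewrite -scalemxAl -(mulmxA _ L A) LA -!scalemxAr scalerA !mulmxA.
have -> : g *: (L *m P *m L) *m b *m b^T *m (g *: (L *m P *m L))
   = (g ^+ 2) *: (L *m (P *m b *m b^T *m P) *m L).
  rewrite -!scalemxAl -scalemxAr scalerA; congr (_ *: _).
  by rewrite -(mulmxA _ L b) Lb !mulmxA -(mulmxA _ b^T L) bL.
rewrite -scalerDr -scalerBr -mulmxDl -mulmxBl -mulmxDr -mulmxBr PR scale1r.
by rewrite mulmxN mulNmx scalerN scalerA expr2.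
Qed.

Lemma Pgam_unique {R : realType} {n : nat} (g : R) (P : 'M[R]_n) : g != 0 ->
  riccati_sol g P -> Pgam n g = P.
Proof.
move=> g0 PR; apply: xget_unique => // Q QR.
exact: riccati_uniq QR PR.
Qed.

Lemma Pgam1 {R : realType} {n : nat} : Pgam n (1 : R) = Pmat R n.
Proof. exact: Pgam_unique (oner_neq0 _) Pmat_riccati. Qed.

Lemma PgamE {R : realType} {n : nat} (g : R) : 0 < g ->
  Pgam n g = g *: (@Lmat R n g *m Pmat R n *m @Lmat R n g).
Proof.
by move=> g0; apply: Pgam_unique (Lmat_riccati _ _ g0 Pmat_riccati); rewrite gt_eqF.
Qed.

(** * Quadratic bounds by [Lambda] and [delta_c] *)

Lemma posdef1 {R : realType} {n : nat} : posdef (1%:M : 'M[R]_n).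
Proof.
apply: psd_unitmx_posdef (unitmx1 _ _); first exact: trmx1.
by move=> w; rewrite bform1 sumr_ge0 // => i _; rewrite sqr_ge0.
Qed.

Lemma Pmat_le_Lambda {R : realType} {n : nat} (v : 'cV[R]_n) :
  bform (Pmat R n) v v <= Lambda R n * \sum_i v i 0 ^+ 2.
Proof.
have := le_lambda_max (Pmat R n) 1%:M v (proj1 Pmat_posdef) posdef1.
by rewrite invmx1 mulmx1 bform1 /Lambda Pgam1.
Qed.

(* [P] and [P^-1] are similar, so the smallest eigenvalue of [P] is [1 / Lambda]. *)
Lemma Lambda_ge_Pmat {R : realType} {n : nat} (v : 'cV[R]_n) :
  \sum_i v i 0 ^+ 2 <= Lambda R n * bform (Pmat R n) v v.
Proof.
have := le_lambda_max 1%:M (Pmat R n) v (trmx1 _ _) Pmat_posdef.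
rewrite bform1 mul1mx invmx_Pmat.
suff -> : lambda_max (Wmat R n) = Lambda R n by [].
rewrite /Lambda Pgam1 /lambda_max; congr sup.
have detF0 : \det (Fmat R n) != 0.
  apply/eqP => F0; have := congr1 determinant (@Fmat_invol R n).
  by rewrite det_mulmx F0 mul0r det1 => /esym/eqP; rewrite oner_eq0.
(* [F] intertwines the two matrices: [W F = F F^T F = F P]. *)
have H r : \det (r%:M - Wmat R n) = \det (r%:M - Pmat R n).
  apply: (mulIf detF0); rewrite -det_mulmx [RHS]mulrC -det_mulmx.
  by rewrite mulmxBl mulmxBr /Wmat /Pmat mulmxA mul_scalar_mx mul_mx_scalar.
by apply/seteqP; split => r /=; rewrite !rootE !det_char_poly H.
Qed.

Lemma Lambda_gt0 {R : realType} {n : nat} : (0 < n)%N -> 0 < Lambda R n.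
Proof.
case: n => // n _; rewrite ltNge; apply/negP => L0.
have := Lambda_ge_Pmat (delta_mx ord0 0 : 'cV[R]_n.+1).
rewrite leNgt => /negP; apply.
apply: (@le_lt_trans _ _ 0).
  by rewrite mulr_le0_ge0 // posdef_psd // ; apply: Pmat_posdef.
by rewrite (bigD1 ord0) //= mxE !eqxx expr1n ltr_pwDl // sumr_ge0 // => i _; rewrite sqr_ge0.
Qed.

(** [E + P E P^-1 = (E P + P E) P^-1], so the eigenvalue inside [delta_c] is the largest Rayleigh
    quotient of [E P + P E] with respect to [P]. *)
Lemma bform_EP {R : realType} {n : nat} (v : 'cV[R]_n) : (0 < n)%N ->
  2 * bform (Pmat R n) v (@Emat R n *m v)
  <= (delta_c R n / n%:R - 1) * bform (Pmat R n) v v.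
Proof.
move=> n0; have nR : n%:R != 0 :> R by rewrite pnatr_eq0 -lt0n.
rewrite /delta_c (mulrC n%:R) mulfK // addrAC subrr add0r Pgam1.
set E := Emat R n; set P := Pmat R n.
have Esym : E^T = E by rewrite /E Emat_diag tr_diag_mx.
have Psym : P^T = P by case: (@Pmat_posdef R n).
have -> : E + P *m E *m invmx P = (E *m P + P *m E) *m invmx P.
  by rewrite mulmxDl mulmxK // Pmat_unit.
apply: le_trans (le_lambda_max _ _ v _ Pmat_posdef); first last.
  by rewrite linearD /= (trmx_mul E P) (trmx_mul P E) Psym Esym addrC.
rewrite bformD -[E *m P]trmxK bform_trmx trmx_mul Psym Esym bform_mulr.
by rewrite mulr_natl mulr2n.
Qed.

(** The last basis vector lies in the kernel of [E], so the preceding bound there says that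
    [delta_c / n - 1] times a positive number is nonnegative. This gives [beta >= 0]. *)
Lemma delta_c_ge {R : realType} {n : nat} : (0 < n)%N ->
  1 <= delta_c R n / n%:R.
Proof.
case: n => // n _; pose v : 'cV[R]_n.+1 := delta_mx ord_max 0.
have Ev : @Emat R n.+1 *m v = 0.
  rewrite Emat_diag; apply/matrixP => i j; rewrite mul_diag_mx !mxE.
  by case: eqP => [->|_]; rewrite ?subnn ?mul0r ?mulr0.
have := bform_EP v (ltn0Sn n); rewrite Ev /bform mulmx0 mxE mulr0 -/(bform _ v v).
rewrite pmulr_lge0 ?subr_ge0 //; apply: (proj2 Pmat_posdef).
apply/eqP => /matrixP /(_ ord_max 0); rewrite !mxE !eqxx => /eqP.
by rewrite oner_eq0.
Qed.

(** * Dissipation inequality *)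

Lemma sqr_sum_le {R : realType} {I : finType} (Q : pred I) (a : I -> R) :
  (\sum_(i | Q i) a i) ^+ 2 <= (\sum_(i | Q i) 1) * \sum_(i | Q i) a i ^+ 2.
Proof.
set k := \sum_(i | Q i) 1; set S := \sum_(i | Q i) a i ^+ 2.
have -> : k * S = \sum_(i | Q i) \sum_(j | Q j) (a i ^+ 2 + a j ^+ 2) / 2.
  under eq_bigr => i _ do rewrite -mulr_suml big_split /= -/S.
  rewrite -mulr_suml big_split /= exchange_big /=.
  have E : \sum_(i | Q i) S = k * S.
    by rewrite /k mulr_suml; apply: eq_bigr => i _; rewrite mul1r.
  by rewrite E; field.
rewrite expr2 mulr_suml; apply: ler_sum => i _; rewrite mulr_sumr.
apply: ler_sum => j _; have := sqr_ge0 (a i - a j).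
by move: (a i) (a j) => p q h; nra.
Qed.

Lemma sum_ord_le {R : realType} {n : nat} (i : 'I_n) :
  \sum_(j < n | (j <= i)%N) 1 = i.+1%:R :> R.
Proof.
transitivity (\sum_(j < i.+1) (1 : R)); last by rewrite sumr_const card_ord.
by rewrite (big_ord_widen n (fun _ => 1)).
Qed.

(** This explains the form of [d]: Cauchy-Schwarz on the [i + 1] terms of row [i] gives the weight
    [i + 1], and exchanging the sums leaves one column sum per [y_j], bounded by the maximum. *)
Lemma dconst_bound {R : realType} {n : nat} (c : 'I_n -> 'I_n -> R) (T : R)
    (y : 'cV[R]_n) :
  \sum_(i < n) (\sum_(j < n | (j <= i)%N) gcoef c T i j * T ^+ (i - j) * `|y j 0|) ^+ 2
  <= dconst c T ^+ 2 * \sum_i y i 0 ^+ 2.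
Proof.
rewrite /dconst sqr_sqrtr ?bigmax_ge_id //.
pose F (j : 'I_n) := \sum_(i < n | (j <= i)%N)
  gcoef c T i j ^+ 2 * i.+1%:R * (1 / T)^-1 ^+ (2 * (i - j)).
apply: (@le_trans _ _ (\sum_j F j * y j 0 ^+ 2)); last first.
  rewrite mulr_sumr; apply: ler_sum => j _; rewrite ler_wpM2r ?sqr_ge0 //.
  exact: (le_bigmax 0 F).
under [leRHS]eq_bigr => j _ do rewrite /F mulr_suml big_mkcond.
rewrite exchange_big /=; apply: ler_sum => i _.
apply: le_trans (sqr_sum_le _ _) _; rewrite sum_ord_le mulr_sumr -big_mkcond.
apply: ler_sum => j ji.
rewrite !exprMn real_normK ?num_real // div1r invrK mulnC exprM.
by rewrite le_eqVlt; apply/orP; left; apply/eqP; ring.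
Qed.

(** Rescaling turns [c_ij] into [c_ij s^(2(i-j)+1)]. One part [s^(i+1-j)] is bounded inside [g_ij],
    the other [s^(i-j)] by the power of [T] that [d] carries; on the diagonal the entry of [E] is
    the summand [n - i] of [g_ii]. *)
Lemma perturbation_bound {R : realType} {n : nat} (c : 'I_n -> 'I_n -> R)
    (T s : R) (y f : 'cV[R]_n) : 0 < s -> s <= T ->
  (forall i j : 'I_n, (j <= i)%N -> 0 <= c i j) ->
  (forall i, `|f i 0| <=
     \sum_(j < n | (j <= i)%N) c i j * `|s ^+ (2 * (n.-1 - j)) * y j 0|) ->
  \sum_(i < n) ((n.-1 - i)%:R * y i 0 + s * s^-1 ^+ (2 * (n.-1 - i)) * f i 0) ^+ 2
  <= dconst c T ^+ 2 * \sum_i y i 0 ^+ 2.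
Proof.
move=> s0 sT c0 hf; apply: le_trans (dconst_bound c T y); apply: ler_sum => i _.
have T0 : 0 < T by apply: lt_le_trans sT.
rewrite -[leLHS]real_normK ?num_real //.
suff H : `|(n.-1 - i)%:R * y i 0 + s * s^-1 ^+ (2 * (n.-1 - i)) * f i 0| <=
    \sum_(j < n | (j <= i)%N) gcoef c T i j * T ^+ (i - j) * `|y j 0|.
  by rewrite ler_pXn2r // nnegrE // (le_trans _ H).
apply: le_trans (ler_normD _ _) _.
have p0 : 0 < s * s^-1 ^+ (2 * (n.-1 - i)) by rewrite mulr_gt0 // exprn_gt0 // invr_gt0.
rewrite !normrM normr_nat -(normrM s) (gtr0_norm p0).
have := ler_wpM2l (ltW p0) (hf i) => /(lerD (lexx ((n.-1 - i)%:R * `|y i 0|))).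
move=> /le_trans; apply; rewrite mulr_sumr.
have E (j : 'I_n) : (j <= i)%N -> s * s^-1 ^+ (2 * (n.-1 - i)) * (c i j *
    `|s ^+ (2 * (n.-1 - j)) * y j 0|)
   = c i j * s ^+ (i.+1 - j) * s ^+ (i - j) * `|y j 0|.
  move=> ji; rewrite normrM gtr0_norm ?exprn_gt0 //.
  have lti := ltn_ord i.
  have -> : (2 * (n.-1 - j) = 2 * (n.-1 - i) + ((i - j) + (i - j)))%N by lia.
  rewrite subSn // exprS !exprD exprVn; field.
  by rewrite expf_neq0 // gt_eqF.
rewrite (bigD1 i) //= [leRHS](bigD1 i) //= addrA lerD //.
  rewrite E // /gcoef ltnn subSn // subnn expr0 expr1 !mulr1 -mulrDl.
  rewrite ler_wpM2r //.
  have -> : (n.-1 - i = n - i.+1)%N by lia.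
  by rewrite addrC lerD2r ler_wpM2l // c0.
apply: ler_sum => j /andP[ji jni]; rewrite E //.
have ltji : (j < i)%N by move: jni; rewrite -val_eqE /=; lia.
rewrite /gcoef ltji ler_wpM2r //.
have sT' k : s ^+ k <= T ^+ k by rewrite lerXn2r ?nnegrE // ltW.
apply: ler_pM => //; first by rewrite mulr_ge0 ?c0 // exprn_ge0 // ltW.
  by rewrite exprn_ge0 // ltW.
by rewrite ler_wpM2l // c0.
Qed.

Definition betac {R : realType} {n : nat} (c : 'I_n -> 'I_n -> R) (T : R) : R :=
  (2 * n%:R + delta_c R n) / n%:R + 2 * dconst c T * Lambda R n.

Lemma betac_ge0 {R : realType} {n : nat} (c : 'I_n -> 'I_n -> R) (T : R) :
  (0 < n)%N -> 0 <= betac c T.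
Proof.
move=> n0; have nR : n%:R != 0 :> R by rewrite pnatr_eq0 -lt0n.
have := @delta_c_ge R n n0.
have := mulr_ge0 (sqrtr_ge0 _ : 0 <= dconst c T) (ltW (@Lambda_gt0 R n n0)).
rewrite /betac mulrDl mulfK // -mulrA; set a := _ * Lambda R n; set b := _ / _.
by move=> h1 h2; lra.
Qed.

(** Here [a], [p], [q], [e], [h] stand for [y^T P A y], [b^T P y], [y^T P y], [y^T P E y],
    [y^T P theta]. The Riccati identity consumes one of the two copies of [beta p^2], the other is
    dropped by sign, and [- beta + (D - 1) + 2 dL = -3]. *)
Lemma decay_arith {R : realFieldType} (be w a p q e h D dL W : R) :
  0 <= be * p ^+ 2 -> 2 * a - p ^+ 2 = - q -> 2 * e <= (D - 1) * q ->
  h <= dL * q -> w * a <= W * q -> be = 2 + D + 2 * dL ->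
  2 * ((be + w) * a + - (be * p) * p + e + h) <= (- 3 + 2 * W) * q.
Proof.
move=> hp ha he hh hw hbe.
have -> : 2 * ((be + w) * a + - (be * p) * p + e + h)
    = be * (2 * a - p ^+ 2) - be * p ^+ 2 + 2 * (w * a) + 2 * e + 2 * h by ring.
rewrite ha {1}hbe; move: (be * p ^+ 2) hp => bp hp; nra.
Qed.

Lemma closed_loop_decay {R : realType} {n : nat} (c : 'I_n -> 'I_n -> R)
    (T s w C : R) (y th : 'cV[R]_n) : (0 < n)%N -> 0 < s ->
  (forall v, `|bform (Pmat R n *m @Amat R n) v v| <= C * bform (Pmat R n) v v) ->
  \sum_i th i 0 ^+ 2 <= dconst c T ^+ 2 * \sum_i y i 0 ^+ 2 ->
  2 * bform (Pmat R n) y (s^-1 *: ((betac c T + w) *: (@Amat R n *m y)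
      - (betac c T * bform (Pmat R n) (@bvec R n) y) *: @bvec R n
      + @Emat R n *m y + th))
  <= (- 3 / s + 2 * `|w| * C / s) * bform (Pmat R n) y y.
Proof.
move=> n0 s0 hC hth.
have nR : n%:R != 0 :> R by rewrite pnatr_eq0 -lt0n.
set P := Pmat R n; set A := Amat R n; set b := bvec R n; set E := Emat R n.
have Psym : P^T = P by case: (@Pmat_posdef R n).
have Ppsd v : 0 <= bform P v v by apply: posdef_psd Pmat_posdef.
have yb : bform P y b = bform P b y by rewrite -bform_trmx Psym.
have b0 := betac_ge0 c T n0.
rewrite bformZr !bformDr -scaleNr !bformZr yb -bform_mulr.
have Ric : 2 * bform (P *m A) y y - bform P b y ^+ 2 = - bform P y y.
  have := congr1 (fun M => bform M y y) (proj2 (@Pmat_riccati R n)).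
  rewrite -/P -/A -/b bformN bformZ mul1r => <-.
  rewrite !bformD bformN -[A^T *m P]trmxK bform_trmx trmx_mul trmxK Psym.
  congr (_ - _); first by rewrite mulr_natl mulr2n.
  have -> : bform (P *m b *m b^T *m P) y y = bform P y b * bform P b y.
    rewrite /bform (_ : y^T *m _ *m y = (y^T *m P *m b) *m (b^T *m P *m y)).
      by rewrite mxE big_ord1.
    by rewrite !mulmxA.
  by rewrite yb expr2.
have HE := bform_EP y n0; rewrite -/P -/E in HE.
(* Cauchy-Schwarz in [P]; [Lambda] enters twice under the square, once as an upper bound on [P] at
   [theta] and once as a lower bound at [y]. *)
have Hth : bform P y th <= dconst c T * Lambda R n * bform P y y.
  have L0 := @Lambda_gt0 R n n0.
  have d0 : 0 <= dconst c T by exact: sqrtr_ge0.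
  have dL : 0 <= dconst c T * Lambda R n * bform P y y by rewrite !mulr_ge0 // ltW.
  apply: le_trans (ler_norm _) _; rewrite -(ler_pXn2r (ltn0Sn 1)) ?nnegrE //.
  rewrite real_normK ?num_real //.
  apply: le_trans (cauchy_schwarz P y th Psym Ppsd) _.
  have h1 := Pmat_le_Lambda th; have h2 := Lambda_ge_Pmat y; rewrite -/P in h1 h2.
  have h3 : bform P th th <= Lambda R n * (dconst c T ^+ 2 * (Lambda R n * bform P y y)).
    apply: (le_trans h1); apply: (ler_wpM2l (ltW L0)); apply: (le_trans hth).
    by apply: (ler_wpM2l (sqr_ge0 _)).
  apply: le_trans (ler_wpM2l (Ppsd y) h3) _.
  by rewrite le_eqVlt; apply/orP; left; apply/eqP; ring.
have HA : w * bform (P *m A) y y <= `|w| * C * bform P y y.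
  by apply: le_trans (ler_norm _) _; rewrite normrM -mulrA ler_wpM2l.
have Hp := mulr_ge0 b0 (sqr_ge0 (bform P b y)).
have -> : (- 3 / s + 2 * `|w| * C / s) * bform P y y
   = s^-1 * ((- 3 + 2 * `|w| * C) * bform P y y) by ring.
have si : 0 <= s^-1 by rewrite invr_ge0 ltW.
rewrite mulrCA ler_wpM2l //.
have bE : betac c T = 2 + delta_c R n / n%:R + 2 * (dconst c T * Lambda R n).
  by rewrite /betac mulrDl mulfK // -mulrA.
rewrite -(mulrA 2 `|w|); exact: decay_arith Hp Ric HE Hth HA bE.
Qed.

(** * Scalar differential equations and inequalities *)

Lemma is_derive_mul {R : realType} (f g : R -> R) (t df dg : R) :
  is_derive t 1 f df -> is_derive t 1 g dg ->
  is_derive t 1 (fun x => f x * g x) (df * g t + f t * dg).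
Proof.
move=> hf hg; apply: (is_derive_eq (is_deriveM hf hg)).
by rewrite /GRing.scale /=; ring.
Qed.

Lemma is_derive_invX {R : realType} (T t : R) k : t < T ->
  is_derive t 1 (fun x => (T - x)^-1 ^+ k) (k%:R * (T - t)^-1 ^+ k.+1).
Proof.
move=> tT; have s0 : T - t != 0 by rewrite subr_eq0 gt_eqF.
have hs : is_derive t 1 (fun x => T - x) (- 1).
  by apply: (is_derive_eq (is_deriveB (is_derive_cst T t 1) (is_derive_id t 1))); rewrite sub0r.
have hV : is_derive t 1 (fun x => (T - x)^-1) ((T - t)^-1 ^+ 2).
  apply: (is_derive_eq (@is_deriveV R (fun x => T - x) t (-1) 1 s0 hs)).
  by rewrite /GRing.scale /= mulrN1 opprK exprVn.
elim: k => [|k IHk].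
  by under eq_fun do rewrite expr0; rewrite mul0r; exact: is_derive_cst.
under eq_fun do rewrite exprS.
apply: (is_derive_eq (is_derive_mul _ _ _ _ _ hV IHk)).
by rewrite -natr1 !exprS; ring.
Qed.

Lemma is_derive_continuous {R : realType} (f : R -> R) (t df : R) :
  is_derive t 1 f df -> {for t, continuous f}.
Proof.
by move=> [hf _]; apply: differentiable_continuous; apply/derivable1_diffP.
Qed.

Lemma continuous_within_mul {R : realType} (A : set R) (f g : R -> R) :
  {within A, continuous f} -> {within A, continuous g} ->
  {within A, continuous (fun x => f x * g x)}.
Proof. by move=> hf hg z; exact: cvgM (hf z) (hg z). Qed.

Lemma continuous_within_add {R : realType} (A : set R) (f g : R -> R) :
  {within A, continuous f} -> {within A, continuous g} ->
  {within A, continuous (fun x => f x + g x)}.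
Proof. by move=> hf hg z; exact: cvgD (hf z) (hg z). Qed.

Lemma continuous_within_sum {R : realType} (A : set R) (I : finType)
    (f : I -> R -> R) : (forall i, {within A, continuous (f i)}) ->
  {within A, continuous (fun x => \sum_i f i x)}.
Proof.
move=> hf z; apply: cvg_big => [|i _]; last exact: hf.
exact: add_continuous.
Qed.

Lemma continuous_within_derivable {R : realType} (T : R) (f df : R -> R) :
  (forall t, t < T -> is_derive t 1 f (df t)) ->
  {within `[0, T[, continuous f}.
Proof.
move=> hf; apply: continuous_in_subspaceT => t /set_mem /=; rewrite in_itv /=.
by move=> /andP[_ /hf]; exact: is_derive_continuous.
Qed.

(** The equations hold only inside [(0, T)], while comparison is with the value at 0, reached by
    one-sided continuity. *)
Lemma mean_value_from0 {R : realType} (T : R) (f df : R -> R) :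
  {within `[0, T[, continuous f} ->
  (forall t, 0 < t < T -> is_derive t 1 f (df t)) ->
  forall t, 0 < t < T -> exists2 u, 0 < u < T & f t - f 0 = df u * t.
Proof.
move=> cf hf t /andP[t0 tT].
have [||u] := @MVT R f df 0 t t0.
- by move=> x; rewrite in_itv /= => /andP[x0 xt]; apply: hf; rewrite x0 (lt_trans xt).
- apply: continuous_subspaceW cf => x /=; rewrite !in_itv /= => /andP[-> xt] /=.
  exact: le_lt_trans tT.
rewrite in_itv /= subr0 => /andP[u0 ut] E.
by exists u => //; rewrite u0 (lt_trans ut).
Qed.

Lemma x0_solution {R : realType} (T be : R) (x0 : R -> R) : 0 < T ->
  {within `[0, T[, continuous x0} ->
  (forall t, 0 < t < T ->
    is_derive t 1 x0 (- (3 / (T - t)) * x0 t - be / 2 * (T - t))) ->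
  forall t, 0 <= t < T ->
  x0 t = (T - t) ^+ 3 / T ^+ 3 * x0 0 - be * t * (T - t) ^+ 2 / (2 * T).
Proof.
move=> T0 cx hx t /andP[t0 tT].
have Tn : T != 0 by rewrite gt_eqF.
have s0 : T - t != 0 by rewrite subr_eq0 gt_eqF.
(* The integrating factor [(T - u)^-3] turns the inhomogeneity into [- beta / 2 (T - u)^-2]; adding
   its negated primitive makes [G] a first integral. *)
pose G u := x0 u * (T - u)^-1 ^+ 3 + be / 2 * (T - u)^-1 ^+ 1.
suff E : G t = G 0.
  have -> : x0 t = (G t - be / 2 * (T - t)^-1 ^+ 1) * (T - t) ^+ 3.
    by rewrite /G; field.
  by rewrite E /G subr0; field; rewrite Tn s0.
move: t0; rewrite le_eqVlt => /predU1P[<-//|t0].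
have [|||u /andP[u0 uT]] := @mean_value_from0 R T G (fun=> 0) _ _ t.
- apply: continuous_within_add; apply: continuous_within_mul => //.
  + by apply: continuous_within_derivable => v; exact: is_derive_invX.
  + exact/continuous_subspaceT/cst_continuous.
  + by apply: continuous_within_derivable => v; exact: is_derive_invX.
- move=> u /andP[u0 uT].
  have su : T - u != 0 by rewrite subr_eq0 gt_eqF.
  have hxu := hx u; rewrite u0 uT in hxu.
  apply: (is_derive_eq (is_deriveD
    (is_derive_mul _ _ _ _ _ (hxu isT) (is_derive_invX T u 3 uT))
    (is_derive_mul _ _ _ _ _ (is_derive_cst (be / 2) u 1) (is_derive_invX T u 1 uT)))).
  by rewrite /=; field.
- by rewrite t0.
by move/eqP; rewrite mul0r subr_eq0 => /eqP.
Qed.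

Lemma gronwall_finite_time {R : realType} (T ka : R) (q dq : R -> R) : 0 < T ->
  {within `[0, T[, continuous q} ->
  (forall t, 0 < t < T -> is_derive t 1 q (dq t)) ->
  (forall t, 0 < t < T -> dq t <= (- 3 / (T - t) + ka) * q t) ->
  forall t, 0 <= t < T ->
  q t <= (T - t) ^+ 3 / T ^+ 3 * expR (ka * t) * q 0.
Proof.
move=> T0 cq hq le_dq t /andP[t0 tT].
have Tn : T != 0 by rewrite gt_eqF.
have s0 : 0 < T - t by rewrite subr_gt0.
have sn : T - t != 0 by rewrite gt_eqF.
have hexp (u : R) : is_derive u 1 (fun x : R => expR (- ka * x)) (- ka * expR (- ka * u)).
  have h : is_derive u 1 (fun x : R => - ka * x) (- ka).
    apply: (is_derive_eq (is_derive_mul _ _ _ _ _ (is_derive_cst (- ka) u 1) (is_derive_id u 1))).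
    by rewrite mul0r add0r mulr1.
  by apply: (is_derive_eq (is_derive1_comp (is_derive_expR _) h)); rewrite mulrC.
(* The integrating factor of the comparison equation, so that [F] has nonpositive derivative. *)
pose F u := q u * ((T - u)^-1 ^+ 3 * expR (- ka * u)).
suff E : F t <= F 0.
  have -> : q t = F t * ((T - t) ^+ 3 * expR (ka * t)).
    rewrite /F mulNr expRN; field.
    by rewrite sn gt_eqF // expR_gt0.
  apply: le_trans (ler_wpM2r _ E) _.
    by rewrite mulr_ge0 ?expR_ge0 // exprn_ge0 // ltW.
  rewrite /F subr0 mulr0 expR0 mulr1 le_eqVlt; apply/orP; left; apply/eqP.
  by field.
move: t0; rewrite le_eqVlt => /predU1P[<-//|t0].
pose dF u := (dq u - (- 3 / (T - u) + ka) * q u) * ((T - u)^-1 ^+ 3 * expR (- ka * u)).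
have [|||u /andP[u0 uT] E] := @mean_value_from0 R T F dF _ _ t.
- apply: continuous_within_mul => //; apply: continuous_within_mul.
    by apply: continuous_within_derivable => v; exact: is_derive_invX.
  by apply: continuous_within_derivable => v _; exact: hexp.
- move=> u /andP[u0 uT].
  have su : T - u != 0 by rewrite subr_eq0 gt_eqF.
  have hqu := hq u; rewrite u0 uT in hqu.
  apply: (is_derive_eq (is_derive_mul _ _ _ _ _ (hqu isT)
    (is_derive_mul _ _ _ _ _ (is_derive_invX T u 3 uT) (hexp u)))).
  by rewrite /dF; field.
- by rewrite t0.
rewrite -subr_le0 E; apply: mulr_le0_ge0; last exact: ltW.
apply: mulr_le0_ge0; first by rewrite subr_le0 le_dq // u0.
by rewrite mulr_ge0 ?expR_ge0 // exprn_ge0 // invr_ge0 subr_ge0 ltW.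
Qed.

Lemma is_derive_bform {R : realType} {n : nat} (P : 'M[R]_n)
    (y : R -> 'cV[R]_n) (dy : 'cV[R]_n) (t : R) : P^T = P ->
  (forall i, is_derive t 1 (fun u => y u i 0) (dy i 0)) ->
  is_derive t 1 (fun u => bform P (y u) (y u)) (2 * bform P (y t) dy).
Proof.
move=> Psym hy.
have h i j := is_derive_mul _ _ _ _ _ (is_derive_cst (P i j) t 1)
  (is_derive_mul _ _ _ _ _ (hy i) (hy j)).
have := is_derive_sum (fun i => is_derive_sum (fun j => h i j)).
under eq_bigr => i _ do rewrite fct_sumE.
rewrite fct_sumE => H.
under eq_fun => u do rewrite bform_sum.
apply: (is_derive_eq H).
have -> : 2 * bform P (y t) dy = bform P dy (y t) + bform P (y t) dy.
  by rewrite -[in RHS]Psym bform_trmx Psym mulr_natl mulr2n.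
rewrite !bform_sum -big_split; apply: eq_bigr => i _.
rewrite -big_split; apply: eq_bigr => j _ /=; ring.
Qed.

Lemma continuous_bform {R : realType} {n : nat} (A : set R) (P : 'M[R]_n)
    (y : R -> 'cV[R]_n) :
  (forall i, {within A, continuous (fun u => y u i 0)}) ->
  {within A, continuous (fun u => bform P (y u) (y u))}.
Proof.
move=> hy.
have -> : (fun u => bform P (y u) (y u)) =
    (fun u => \sum_i \sum_j P i j * (y u i 0 * y u j 0)).
  by apply/funext => u; rewrite bform_sum.
apply: continuous_within_sum => i; apply: continuous_within_sum => j.
apply: continuous_within_mul; last exact: continuous_within_mul.
exact/continuous_subspaceT/cst_continuous.
Qed.

(** * The rescaled closed loop *)

(* With [s = T - t] this is [L(gamma) L(1/s) x] at [gamma = 1/s]. *)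
Definition rescale {R : realType} {n : nat} (s : R) (v : 'cV[R]_n) : 'cV[R]_n :=
  \col_i (s^-1 ^+ (2 * (n.-1 - i)) * v i 0).

Lemma rescale_Lmat {R : realType} {n : nat} (s : R) (v : 'cV[R]_n) :
  @Lmat R n s^-1 *m (@Lmat R n s^-1 *m v) = rescale s v.
Proof.
apply/matrixP => i j; rewrite ord1 mulmxA Lmat_mul Lmat_diag mul_diag_mx !mxE.
by rewrite -expr2 -exprM.
Qed.

(** In [P(1/s) = s^-1 L P L] the left [L] is absorbed by [b^T], and the right one meets the [L(1/s)]
    of the controller: hence the factor 2 in the exponents of [rescale]. *)
Lemma feedback_rescale {R : realType} {n : nat} (s : R) (v : 'cV[R]_n) : 0 < s ->
  ((@bvec R n)^T *m Pgam n s^-1 *m @Lmat R n s^-1 *m v) 0 0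
  = s^-1 * bform (Pmat R n) (@bvec R n) (rescale s v).
Proof.
move=> s0; rewrite PgamE ?invr_gt0 // /bform -rescale_Lmat.
set L := Lmat _ _; set b := bvec _ _.
have bL : b^T *m L = b^T by rewrite -[L]Lmat_sym -trmx_mul Lmat_bvec.
by rewrite -scalemxAr -!scalemxAl mxE !mulmxA bL.
Qed.

(** Neighbouring weights differ by [s^-2]; together with [u0 = s (beta + w)] this yields the common
    factor [1 / s]. *)
Lemma rescale_Amat {R : realType} {n : nat} (s : R) (v : 'cV[R]_n) (i : 'I_n) :
  s^-1 ^+ (2 * (n.-1 - i)) * (@Amat R n *m v) i 0
  = s^-1 ^+ 2 * (@Amat R n *m rescale s v) i 0.
Proof.
rewrite !mxE !mulr_sumr; apply: eq_bigr => k _; rewrite !mxE.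
case: eqP => [ki|_]; last by rewrite !mul0r !mulr0.
have -> : (2 * (n.-1 - i) = 2 + 2 * (n.-1 - k))%N.
  by have := ltn_ord k; lia.
by rewrite exprD; ring.
Qed.

Lemma unscale {R : realType} {n : nat} (s : R) (v : 'cV[R]_n) (i : 'I_n) : s != 0 ->
  v i 0 = s ^+ (2 * (n.-1 - i)) * rescale s v i 0.
Proof. by move=> s0; rewrite mxE mulrA -exprMn mulfV // expr1n mul1r. Qed.

(** Adding 1 to the base lets one power dominate all smaller ones, whether the base is below or
    above 1. *)
Lemma expr_le_1D {R : realType} (r r' : R) (k m : nat) : 0 <= r -> r <= r' ->
  (k <= m)%N -> r ^+ k <= (1 + r') ^+ m.
Proof.
move=> r0 rr' km.
have h1 : r ^+ k <= (1 + r') ^+ k.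
  by rewrite lerXn2r ?nnegrE //; move: rr' r0; lra.
by apply: le_trans h1 _; apply: ler_weXn2l => //; move: rr' r0; lra.
Qed.

Lemma unscale_sumsq {R : realType} {n : nat} (s T : R) (v : 'cV[R]_n) :
  0 < s -> s <= T ->
  \sum_i v i 0 ^+ 2 <= (1 + T) ^+ (4 * n) * \sum_i rescale s v i 0 ^+ 2.
Proof.
move=> s0 sT; rewrite mulr_sumr; apply: ler_sum => i _.
rewrite [v i 0](unscale s) ?gt_eqF // exprMn -exprM ler_wpM2r ?sqr_ge0 //.
by apply: expr_le_1D sT _; [exact: ltW | lia].
Qed.

Lemma rescale_sumsq {R : realType} {n : nat} (T : R) (v : 'cV[R]_n) : 0 < T ->
  \sum_i rescale T v i 0 ^+ 2 <= (1 + T^-1) ^+ (4 * n) * \sum_i v i 0 ^+ 2.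
Proof.
move=> T0; rewrite mulr_sumr; apply: ler_sum => i _.
rewrite mxE exprMn -exprM ler_wpM2r ?sqr_ge0 //.
by apply: expr_le_1D (lexx _) _; [rewrite invr_ge0 ltW | lia].
Qed.

Lemma col_combE {R : realType} {n : nat} (k a l : R) (u v w z : 'cV[R]_n) i :
  (k *: (a *: u - l *: v + w + z)) i 0
  = k * (a * u i 0 - l * v i 0 + w i 0 + z i 0).
Proof. by rewrite !mxE. Qed.

Lemma rescaled_state_decay {R : realType} {n : nat} (c : 'I_n -> 'I_n -> R)
    (T K C : R) (x f : 'I_n -> R -> R) (U0 w : R -> R) :
  let X t : 'cV[R]_n := \col_i x i t in
  let y t := rescale (T - t) (X t) in
  (0 < n)%N -> 0 < T -> 0 < C ->
  (forall i j : 'I_n, (j <= i)%N -> 0 <= c i j) ->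
  (forall v, `|bform (Pmat R n *m @Amat R n) v v| <= C * bform (Pmat R n) v v) ->
  (forall i, {within `[0, T[, continuous (x i)}) ->
  (forall t, 0 < t < T -> U0 t = (T - t) * (betac c T + w t)) ->
  (forall t, 0 < t < T -> `|w t| <= K * (T - t)) ->
  (forall t i, `|f i t| <= \sum_(j < n | (j <= i)%N) c i j * `|x j t|) ->
  (forall t, 0 < t < T -> forall i, is_derive t 1 (x i)
     (U0 t * (@Amat R n *m X t) i 0
      + (@bvec R n) i 0 *
        (- betac c T * ((T - t)^-1 * bform (Pmat R n) (@bvec R n) (y t)))
      + f i t)) ->
  forall t, 0 <= t < T ->
  bform (Pmat R n) (y t) (y t)
  <= (T - t) ^+ 3 / T ^+ 3 * expR (2 * K * C * t) * bform (Pmat R n) (y 0) (y 0).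
Proof.
move=> X y n0 T0 C0 c0 hC cx hU0 hw hf hx.
set P := Pmat R n; set be := betac c T.
pose dx t i := U0 t * (@Amat R n *m X t) i 0
      + (@bvec R n) i 0 * (- be * ((T - t)^-1 * bform P (@bvec R n) (y t))) + f i t.
pose dy t : 'cV[R]_n := \col_i ((2 * (n.-1 - i))%:R
   * (T - t)^-1 ^+ (2 * (n.-1 - i)).+1 * x i t + (T - t)^-1 ^+ (2 * (n.-1 - i)) * dx t i).
have yE i t : y t i 0 = (T - t)^-1 ^+ (2 * (n.-1 - i)) * x i t by rewrite !mxE.
apply: (gronwall_finite_time _ _ _ (fun t => 2 * bform P (y t) (dy t)) T0).
- apply: continuous_bform => i.
  rewrite (_ : (fun u => y u i 0) = fun u => (T - u)^-1 ^+ (2 * (n.-1 - i)) * x i u);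
    last by apply/funext => u; exact: yE.
  apply: continuous_within_mul => //.
  by apply: continuous_within_derivable => v; exact: is_derive_invX.
- move=> t /[dup] tT /andP[t0 ltT]; apply: is_derive_bform.
    by case: (@Pmat_posdef R n).
  move=> i.
  rewrite (_ : (fun u => y u i 0) = fun u => (T - u)^-1 ^+ (2 * (n.-1 - i)) * x i u);
    last by apply/funext => u; exact: yE.
  apply: (is_derive_eq (is_derive_mul _ _ _ _ _ (is_derive_invX T t _ ltT) (hx t tT i))).
  by rewrite [RHS]mxE.
move=> t /[dup] tT /andP[t0 ltT].
set s := T - t; have s0 : 0 < s by rewrite subr_gt0.
have sn : s != 0 by rewrite gt_eqF.
have sT : s <= T by rewrite lerBlDr lerDl ltW.
pose fv : 'cV[R]_n := \col_i f i t.
(* Differentiating the weights produces [2 E y / s]. One copy of [E y] stays explicit and is charged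
   to [delta_c]; the other goes into [th] and is charged to [d]. *)
pose th : 'cV[R]_n := \col_i
  ((n.-1 - i)%:R * y t i 0 + s * s^-1 ^+ (2 * (n.-1 - i)) * fv i 0).
have -> : dy t = s^-1 *: ((be + w t) *: (@Amat R n *m y t)
   - (be * bform P (@bvec R n) (y t)) *: @bvec R n + @Emat R n *m y t + th).
  apply/matrixP => i j; rewrite ord1 {j}.
  have A1 := rescale_Amat s (X t) i; rewrite -/(y t) in A1.
  rewrite mxE /dx -/s hU0 // -/s -/be.
  have bE : s^-1 ^+ (2 * (n.-1 - i)) * (@bvec R n) i 0 = (@bvec R n) i 0.
    by rewrite mxE; case: eqP => [->|_]; rewrite ?subnn ?mulr1 ?mulr0.
  have Ee : (@Emat R n *m y t) i 0 = (n.-1 - i)%:R * y t i 0.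
    by rewrite Emat_diag mul_diag_mx !mxE.
  rewrite col_combE Ee [th i 0]mxE [fv i 0]mxE.
  rewrite yE -/s natrM exprS.
  move: A1 bE; move: ((_ *m X t) i 0) ((_ *m y t) i 0) (bvec R n i 0) => a a' b.
  move: (s^-1 ^+ (2 * (n.-1 - i))) (bform P (bvec R n) (y t)) => k p A1 bE.
  transitivity (2 * (n.-1 - i)%:R * s^-1 * (k * x i t)
    + s * (be + w t) * (k * a) - k * b * be * s^-1 * p + k * f i t); first by ring.
  by rewrite A1 bE; field.
have hth : \sum_i th i 0 ^+ 2 <= dconst c T ^+ 2 * \sum_i y t i 0 ^+ 2.
  under eq_bigr => i _ do rewrite mxE.
  apply: perturbation_bound => // i; rewrite mxE; apply: le_trans (hf t i) _.
  rewrite le_eqVlt; apply/orP; left; apply/eqP; apply: eq_bigr => j _.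
  by rewrite -unscale // mxE.
apply: le_trans (closed_loop_decay c T s (w t) C _ _ n0 s0 hC hth) _.
apply: ler_wpM2r; first exact: posdef_psd Pmat_posdef.
(* The bound [|w| <= K s] cancels the singular [1 / s], so [w] costs only the bounded rate
   [2 K C]. *)
rewrite lerD2l ler_pdivrMr // -!mulrA ler_wpM2l //.
have := ler_wpM2r (ltW C0) (hw t tT); rewrite -/s => /le_trans; apply.
by rewrite le_eqVlt; apply/orP; left; apply/eqP; ring.
Qed.

(** State and control are estimated through quadratic forms; working with squares keeps fractional
    powers out of the limits. *)
Lemma cvg_left_sqr_le {R : realType} (f : R -> R) (T K : R) : 0 < T ->
  (forall t, 0 <= t < T -> f t ^+ 2 <= K * (T - t)) -> f @ T^'- --> 0.
Proof.
move=> T0 hf.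
have h2 : (fun t => f t ^+ 2) @ T^'- --> 0.
  apply: (@squeeze_cvgr _ _ _ _ (fun=> 0) (fun t => K * (T - t))).
  - near=> t; rewrite sqr_ge0 hf //; apply/andP; split.
      by near: t; exact: nbhs_left_ge.
    by near: t; exact: nbhs_left_lt.
  - exact: cvg_cst.
  apply: cvg_at_left_filter.
  have -> : 0 = K * (T - T) :> R by rewrite subrr mulr0.
  by apply: cvgM; [exact: cvg_cst | apply: cvgB; [exact: cvg_cst | exact: cvg_id]].
apply: norm_cvg0.
have -> : (fun t => `|f t|) = (fun t => Num.sqrt (f t ^+ 2)).
  by apply/funext => t; rewrite sqrtr_sqr.
rewrite -[X in _ --> X]sqrtr0.
by apply: (cvg_comp _ _ h2); exact: sqrt_continuous.
Unshelve. all: by end_near. Qed.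

Lemma sqr_powR_half {R : realType} (s : R) (k : nat) : 0 <= s ->
  (s `^ (k%:R / 2)) ^+ 2 = s ^+ k.
Proof. by move=> s0; rewrite -!powR_mulrn ?powR_ge0 // -powRrM divfK. Qed.

(** * Explicit bounds *)

Lemma le_of_sqr {R : realType} (a b B : R) : 0 <= b -> 0 <= B ->
  a ^+ 2 <= B * b ^+ 2 -> `|a| <= Num.sqrt B * b.
Proof.
move=> b0 B0 h; rewrite -(ler_pXn2r (ltn0Sn 1)) ?nnegrE ?mulr_ge0 ?sqrtr_ge0 //.
by rewrite real_normK ?num_real // exprMn sqr_sqrtr.
Qed.

Lemma x0_bounds {R : realType} (T be a t : R) : 0 < T -> 0 <= be -> 0 <= t < T ->
  let X0 := (T - t) ^+ 3 / T ^+ 3 * a - be * t * (T - t) ^+ 2 / (2 * T) in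
  let W := - 3 * (T - t) * (a / T ^+ 3 + be / (2 * T)) in
  [/\ `|X0| <= (T - t) ^+ 2 * ((T - t) / T ^+ 3 * `|a| + be * t / (2 * T)),
      - (3 / (T - t)) * X0 - be / 2 * (T - t) = (T - t) * (be + W),
      `|W| <= 3 * (`|a| / T ^+ 3 + be / (2 * T)) * (T - t) &
      `|(T - t) * (be + W)|
        <= (T - t) * (3 * (T - t) * (`|a| / T ^+ 3 + be / (2 * T)) + be)].
Proof.
move=> T0 be0 /andP[t0 tT] X0 W; set s := T - t.
have Tn : T != 0 by rewrite gt_eqF.
have s0 : 0 < s by rewrite subr_gt0.
have sn : s != 0 by rewrite gt_eqF.
have hW : `|W| <= 3 * (`|a| / T ^+ 3 + be / (2 * T)) * s.
  rewrite /W -/s !normrM normrN normr_nat (gtr0_norm s0) [leRHS]mulrAC.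
  rewrite ler_wpM2l ?mulr_ge0 ?(ltW s0) //.
  apply: le_trans (ler_normD _ _) _; rewrite normrM (gtr0_norm (_ : 0 < (T ^+ 3)^-1)).
    by rewrite lerD2l ger0_norm // divr_ge0 // mulr_ge0 // ltW.
  by rewrite invr_gt0 exprn_gt0.
split => //.
- apply: le_trans (ler_normB _ _) _; rewrite -/s.
  rewrite normrM (gtr0_norm (_ : 0 < s ^+ 3 / T ^+ 3)) ?divr_gt0 ?exprn_gt0 //.
  rewrite (ger0_norm (_ : 0 <= be * t * s ^+ 2 / (2 * T))).
    by rewrite le_eqVlt; apply/orP; left; apply/eqP; field.
  by rewrite divr_ge0 ?mulr_ge0 ?exprn_ge0 // ltW.
(* The particular part of [x0] contributes [3 beta s / 2] to [u0] up to order [s^2]; the feedback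
   term [- beta s / 2] leaves exactly [beta s]. *)
- rewrite /X0 /W -/s (_ : t = T - s); last by rewrite /s; ring.
  by field; rewrite sn Tn.
rewrite normrM (gtr0_norm s0) ler_wpM2l ?(ltW s0) //.
apply: le_trans (ler_normD _ _) _; rewrite (ger0_norm be0) addrC lerD2r.
by apply: le_trans hW _; rewrite mulrAC.
Qed.

Lemma cvg_left_norm_le {R : realType} (f : R -> R) (T K : R) : 0 < T ->
  (forall t, 0 <= t < T -> `|f t| <= K * (T - t)) -> f @ T^'- --> 0.
Proof.
move=> T0 hf; apply: (cvg_left_sqr_le f T (K ^+ 2 * T) T0).
move=> t /[dup] tT /andP[t0 ltT].
have s0 : 0 <= T - t by rewrite subr_ge0 ltW.
rewrite -[leLHS]real_normK ?num_real //; have h := hf t tT.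
apply: (@le_trans _ _ ((K * (T - t)) ^+ 2)).
  by rewrite ler_pXn2r // nnegrE (le_trans _ h).
rewrite exprMn -mulrA ler_wpM2l ?sqr_ge0 // expr2 ler_wpM2r //.
by rewrite lerBlDr lerDl.
Qed.

Theorem theorem1 (R : realType) (n : nat) (c : 'I_n -> 'I_n -> R) (T : R)
  (phi : 'I_n -> R -> R -> 'cV[R]_n -> R) :
  (0 < n)%N -> 0 < T ->
  (forall i j : 'I_n, (j <= i)%N -> 0 <= c i j) ->
  (forall i, continuous (fun p : R * R * 'cV[R]_n => phi i p.1.1 p.1.2 p.2)) ->
  (forall i t v (x : 'cV[R]_n),
      `|phi i t v x| <= \sum_(j < n | (j <= i)%N) c i j * `|x j 0|) ->
  let g0 := 1 / T in
  let beta := (2 * n%:R + delta_c R n) / n%:R + 2 * dconst c T * Lambda R n in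
  exists u1 u10 u2 u20 : R, 0 < u1 /\ 0 < u10 /\ 0 < u2 /\ 0 < u20 /\
  forall (x0 : R -> R) (x : 'I_n -> R -> R),
    let X t : 'cV[R]_n := \col_i x i t in
    let gam t := T / (T - t) * g0 in
    let U0 t := - (3 / (T - t)) * x0 t - beta / 2 * (T - t) in
    let U t := - beta *
        ((@bvec R n)^T *m @Pgam R n (gam t) *m @Lmat R n (1 / (T - t)) *m X t) 0 0 in
    {within `[0, T[, continuous x0} ->
    (forall i, {within `[0, T[, continuous (x i)}) ->
    (forall t, 0 < t < T ->
       is_derive t 1 x0 (U0 t) /\
       forall i : 'I_n, is_derive t 1 (x i)
         (U0 t * (@Amat R n *m X t) i 0 + (@bvec R n) i 0 * U t
          + phi i t (U t) (X t))) ->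
    (forall t, 0 <= t < T ->
       `|x0 t| <= (T - t) ^+ 2 * ((T - t) / T ^+ 3 * `|x0 0| + beta * t / (2 * T))
       /\ `|U0 t| <= (T - t) * (3 * (T - t) * (`|x0 0| / T ^+ 3 + beta / (2 * T)) + beta)
       /\ enorm (X t) <= u1 * (T - t) `^ (3 / 2) * expR (u10 * `|x0 0| * t) * enorm (X 0)
       /\ `|U t| <= u2 * (T - t) `^ (1 / 2) * expR (u20 * `|x0 0| * t) * enorm (X 0))
    /\ (x0 @ T^'- --> 0) /\ (U0 @ T^'- --> 0)
    /\ (forall i, x i @ T^'- --> 0) /\ (U @ T^'- --> 0).

Proof.
move=> n0 T0 c0 _ hphi g0 beta.
have -> : beta = betac c T by [].
set be := betac c T.
have be0 : 0 <= be := betac_ge0 c T n0.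
set P := Pmat R n; set b := bvec R n; set La := Lambda R n.
have La0 : 0 < La := Lambda_gt0 n0.
have Ppsd v : 0 <= bform P v v by apply: posdef_psd Pmat_posdef.
have T0' := ltW T0.
have [C C0 hC] := bform_bounded_posdef (P *m Amat R n) P Pmat_posdef.
have Tn : T != 0 by rewrite gt_eqF.
(* The growth rate splits as [2 K C = k0 + k1 |x0(0)|]. The part [k0] is absorbed into [Q] through
   [expR (k0 * T)], so that only [|x0(0)|] stays in the exponent. *)
pose k1 := 6 * C / T ^+ 3; pose k0 := 3 * C * be / T.
pose Q := La * (1 + T^-1) ^+ (4 * n) * expR (k0 * T) / T ^+ 3.
have k1_gt0 : 0 < k1 by rewrite divr_gt0 ?mulr_gt0 ?exprn_gt0.
have k0_ge0 : 0 <= k0 by rewrite divr_ge0 ?mulr_ge0 // ltW.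
have Ti0 : 0 < 1 + T^-1 by rewrite ltr_wpDr ?invr_ge0 ?(ltW T0).
have T10 : 0 < 1 + T by rewrite ltr_wpDr ?(ltW T0).
have Q0 : 0 < Q by rewrite divr_gt0 ?exprn_gt0 // !mulr_gt0 ?exprn_gt0 ?expR_gt0.
pose B1 := (1 + T) ^+ (4 * n) * La * Q.
pose B2 := (1 + be ^+ 2 * bform P b b) * Q.
have B10 : 0 < B1.
  by apply: mulr_gt0 => //; apply: mulr_gt0 => //; exact: exprn_gt0.
have B20 : 0 < B2.
  by rewrite mulr_gt0 // ltr_pwDl // mulr_ge0 ?sqr_ge0.
(* [B1] and [B2] bound squares, hence the roots and the halved rate. *)
exists (Num.sqrt B1), (k1 / 2), (Num.sqrt B2), (k1 / 2).
have k20 : 0 < k1 / 2 by rewrite divr_gt0.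
split; first by rewrite sqrtr_gt0.
split=> //; split; first by rewrite sqrtr_gt0.
split=> // x0 x X gam U0 U cx0 cx hode.
have x0E t : 0 <= t < T -> x0 t = (T - t) ^+ 3 / T ^+ 3 * x0 0
    - be * t * (T - t) ^+ 2 / (2 * T).
  by apply: x0_solution => // u /hode[].
pose w t := - 3 * (T - t) * (x0 0 / T ^+ 3 + be / (2 * T)).
have U0E t : 0 <= t < T -> U0 t = (T - t) * (be + w t).
  move=> tT; have [_ + _ _] := x0_bounds T be (x0 0) t T0 be0 tT.
  by rewrite -x0E.
pose y t := rescale (T - t) (X t).
have UE t : 0 <= t < T -> U t = - be * ((T - t)^-1 * bform P b (y t)).
  move=> /andP[_ tT]; rewrite /U /gam /g0 /y /P /b.
  rewrite (_ : T / (T - t) * (1 / T) = (T - t)^-1); last first.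
    by field; rewrite Tn subr_eq0 gt_eqF.
  by rewrite div1r feedback_rescale // subr_gt0.
pose q t := bform P (y t) (y t).
pose K := 3 * (`|x0 0| / T ^+ 3 + be / (2 * T)).
have qle t : 0 <= t < T ->
    q t <= (T - t) ^+ 3 / T ^+ 3 * expR (2 * K * C * t) * q 0.
  apply: (rescaled_state_decay c T K C x (fun i t => phi i t (U t) (X t)) U0 w) => //.
  - by move=> u /andP[u0 uT]; rewrite U0E // (ltW u0).
  - move=> u /andP[u0 uT]; have uT' : 0 <= u < T by rewrite (ltW u0).
    by have [] := x0_bounds T be (x0 0) u T0 be0 uT'.
  - move=> t' i; apply: le_trans (hphi _ _ _ _) _.
    by under eq_bigr => j _ do rewrite mxE.
  - move=> u /[dup] uT /andP[u0 ltu] i.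
    rewrite -UE ?ltu ?(ltW u0) //.
    by have [_] := hode u uT.
pose S0 := \sum_i X 0 i 0 ^+ 2.
have S00 : 0 <= S0 by rewrite sumr_ge0 // => i _; rewrite sqr_ge0.
pose E t := expR (k1 / 2 * `|x0 0| * t).
have E2 t : E t ^+ 2 = expR (k1 * `|x0 0| * t).
  by rewrite /E expr2 -expRD; congr expR; field.
have qS t : 0 <= t < T -> q t <= Q * (T - t) ^+ 3 * E t ^+ 2 * S0.
  move=> /[dup] tT /andP[t0 ltT]; apply: le_trans (qle t tT) _.
  have q0 : q 0 <= La * ((1 + T^-1) ^+ (4 * n) * S0).
    apply: le_trans (Pmat_le_Lambda _) _; apply: (ler_wpM2l (ltW La0)).
    by rewrite /y subr0; exact: rescale_sumsq.
  have Kle : expR (2 * K * C * t) <= expR (k0 * T) * E t ^+ 2.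
    rewrite E2 -expRD ler_expR.
    have -> : 2 * K * C * t = k0 * t + k1 * `|x0 0| * t by rewrite /K /k0 /k1; field.
    by rewrite lerD2r ler_wpM2l // ltW.
  have s3 : 0 <= (T - t) ^+ 3 / T ^+ 3.
    by rewrite divr_ge0 ?exprn_ge0 // ?subr_ge0 ltW.
  have -> : Q * (T - t) ^+ 3 * E t ^+ 2 * S0
     = (T - t) ^+ 3 / T ^+ 3 * (expR (k0 * T) * E t ^+ 2) * (La * ((1 + T^-1) ^+ (4 * n) * S0)).
    by rewrite /Q; ring.
  apply: ler_pM => //.
  - by rewrite mulr_ge0 ?expR_ge0.
  - exact: Ppsd.
  - exact: ler_wpM2l.
have XS t : 0 <= t < T ->
    \sum_i X t i 0 ^+ 2 <= B1 * ((T - t) ^+ 3 * E t ^+ 2 * S0).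
  move=> /[dup] tT /andP[t0 ltT].
  have s0 : 0 < T - t by rewrite subr_gt0.
  have sT : T - t <= T by rewrite lerBlDr lerDl.
  apply: le_trans (unscale_sumsq _ T _ s0 sT) _.
  rewrite /B1 -!mulrA; apply: ler_wpM2l; first by rewrite exprn_ge0 // ltW.
  apply: le_trans (Lambda_ge_Pmat _) _; apply: (ler_wpM2l (ltW La0)).
  by have := qS t tT; rewrite -!mulrA.
have US t : 0 <= t < T -> U t ^+ 2 <= B2 * ((T - t) * E t ^+ 2 * S0).
  move=> /[dup] tT /andP[t0 ltT].
  have s0 : 0 < T - t by rewrite subr_gt0.
  have sn : T - t != 0 by rewrite gt_eqF.
  rewrite UE // !exprMn sqrrN.
  have h1 := cauchy_schwarz P b (y t) (proj1 Pmat_posdef) Ppsd.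
  have h2 := le_trans h1 (ler_wpM2l (Ppsd b) (qS t tT)).
  have h3 : 0 <= be ^+ 2 * (T - t)^-1 ^+ 2 by rewrite mulr_ge0 ?sqr_ge0.
  rewrite mulrA; apply: le_trans (ler_wpM2l h3 h2) _.
  (* The squared feedback gain costs [s^-2], leaving one power of the [s^3] in [q]: the origin of
     the exponent 1/2 for [u]. *)
  have -> : be ^+ 2 * (T - t)^-1 ^+ 2 * (bform P b b * (Q * (T - t) ^+ 3 * E t ^+ 2 * S0))
    = be ^+ 2 * bform P b b * Q * ((T - t) * E t ^+ 2 * S0) by field.
  rewrite /B2; apply: ler_wpM2r.
    by apply: mulr_ge0 => //; apply: mulr_ge0 (ltW s0) (sqr_ge0 _).
  by rewrite mulrDl mul1r lerDr ltW.
have enormX t : enorm (X t) ^+ 2 = \sum_i X t i 0 ^+ 2.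
  by rewrite sqr_sqrtr // sumr_ge0 // => i _; rewrite sqr_ge0.
(* The limits need a bound uniform in [t]; the exponential at [T] provides it. *)
have Emax t : 0 <= t < T -> E t ^+ 2 <= E T ^+ 2.
  move=> /andP[t0 ltT]; rewrite !E2 ler_expR; apply: ler_wpM2l; last exact: ltW.
  by rewrite mulr_ge0 // ltW.
have s2 t : 0 <= t < T -> 0 <= T - t /\ T - t <= T.
  by move=> /andP[t0 ltT]; rewrite subr_ge0 ltW // lerBlDr lerDl.
split; first move=> t /[dup] tT /andP[t0 ltT].
  have [h1 _ _ h4] := x0_bounds T be (x0 0) t T0 be0 tT.
  have s0 : 0 <= T - t by rewrite subr_ge0 ltW.
  split; first by rewrite x0E.
  split; first by rewrite U0E.
  split.
    rewrite -/(E t) -!mulrA; apply: le_trans (ler_norm _) _; apply: le_of_sqr (ltW B10) _.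
      by rewrite !mulr_ge0 ?powR_ge0 ?expR_ge0 ?sqrtr_ge0.
    rewrite enormX !exprMn (sqr_powR_half _ 3) // enormX.
    by rewrite (mulrA ((T - t) ^+ 3)); exact: XS.
  rewrite -/(E t) -!mulrA; apply: le_of_sqr (ltW B20) _.
    by rewrite !mulr_ge0 ?powR_ge0 ?expR_ge0 ?sqrtr_ge0.
  move: (U t) (US t tT) => ut hut.
  by rewrite !exprMn (sqr_powR_half _ 1) // enormX expr1 (mulrA (T - t)).
split.
  apply: (cvg_left_norm_le _ T (T * (T / T ^+ 3 * `|x0 0| + be * T / (2 * T)))) => //.
  move=> t /[dup] tT /andP[t0 ltT].
  have [s0 sT] := s2 t tT.
  have [h1 _ _ _] := x0_bounds T be (x0 0) t T0 be0 tT.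
  rewrite x0E //; apply: le_trans h1 _; rewrite expr2 -mulrA mulrC.
  apply: ler_wpM2r => //.
  have h : (T - t) / T ^+ 3 * `|x0 0| + be * t / (2 * T)
      <= T / T ^+ 3 * `|x0 0| + be * T / (2 * T).
    apply: lerD; first by rewrite !ler_wpM2r // invr_ge0 exprn_ge0 // ltW.
    rewrite ler_wpM2r ?invr_ge0 ?mulr_ge0 ?(ltW T0) //.
    by apply: ler_wpM2l => //; exact: ltW.
  apply: ler_pM => //.
  by apply: addr_ge0; [rewrite mulr_ge0 // divr_ge0 // exprn_ge0|rewrite divr_ge0 ?mulr_ge0].
split.
  apply: (cvg_left_norm_le _ T (3 * T * (`|x0 0| / T ^+ 3 + be / (2 * T)) + be)) => //.
  move=> t /[dup] tT /andP[t0 ltT].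
  have [s0 sT] := s2 t tT.
  have [_ _ _ h4] := x0_bounds T be (x0 0) t T0 be0 tT.
  rewrite U0E //; apply: le_trans h4 _; rewrite [leLHS]mulrC.
  apply: ler_wpM2r => //; rewrite lerD2r; apply: ler_wpM2r.
    by apply: addr_ge0; [rewrite divr_ge0 // exprn_ge0|rewrite divr_ge0 ?mulr_ge0].
  exact: ler_wpM2l.
split=> [i|].
  apply: (cvg_left_sqr_le _ T (B1 * (T ^+ 2 * E T ^+ 2 * S0))) => // t tT.
  have [s0 sT] := s2 t tT.
  have -> : x i t = X t i 0 by rewrite mxE.
  apply: le_trans (sqr_le_sumsq (X t) i) _; apply: le_trans (XS t tT) _.
  rewrite -[leRHS]mulrA; apply: (ler_wpM2l (ltW B10)).
  have -> : (T - t) ^+ 3 * E t ^+ 2 * S0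
     = (T - t) ^+ 2 * E t ^+ 2 * S0 * (T - t) by ring.
  apply: ler_wpM2r => //; apply: ler_wpM2r => //.
  by apply: ler_pM; rewrite ?sqr_ge0 ?Emax // lerXn2r ?nnegrE // ltW.
apply: (cvg_left_sqr_le _ T (B2 * (E T ^+ 2 * S0))) => // t tT.
have [s0 sT] := s2 t tT.
apply: le_trans (US t tT) _; rewrite -[leRHS]mulrA; apply: (ler_wpM2l (ltW B20)).
rewrite -mulrA mulrC; apply: ler_wpM2r => //; apply: ler_wpM2r => //.
exact: Emax.
Qed.
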